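(* Let $(f_{s,h})_s, \mathbf{E}_h, \mathbf{B}_h$ be a solution of the semi-discrete (continuous-in-time) discontinuous Galerkin Vlasov–Maxwell scheme described in the context, with central fluxes used for Maxwell's equations, i.e. $\hat{\mathbf{E}}_h = (\mathbf{E}_h^+ + \mathbf{E}_h^-)/2$ and $\hat{\mathbf{B}}_h = (\mathbf{B}_h^+ + \mathbf{B}_h^-)/2$ on every face. If the function $(\mathbf{x},\mathbf{v})\mapsto|\mathbf{v}|^2$ belongs to $\mathcal{V}_h^p$, then the scheme conserves the total (particles plus field) energy exactly: $$\frac{d}{dt}\sum_{j}\sum_s\int_{K_j}\frac12 m_s|\mathbf{v}|^2 f_{s,h}\,d\mathbf{z}+\frac{d}{dt}\sum_j\int_{\Omega_j}\left(\frac{\epsilon_0}{2}|\mathbf{E}_h|^2+\frac{1}{2\mu_0}|\mathbf{B}_h|^2\right)d\mathbf{x}=0,$$ where the first sum over $j$ is over all phase-space cells and the second over all configuration-space cells.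
   Context: Phase space is $K=\Omega\times V$ with configuration space $\Omega\subset\mathbb{R}^3$ and velocity space $V\subset\mathbb{R}^3$ (boxes), points $\mathbf{z}=(\mathbf{x},\mathbf{v})$, and $\nabla_{\mathbf{z}}=(\nabla_{\mathbf{x}},\nabla_{\mathbf{v}})$. $\mathcal{T}$ is a Cartesian mesh of $K$ with finitely many cells $K_j$, each a product of a configuration-space cell and a velocity-space cell; $\mathcal{T}_\Omega$ is the induced mesh of $\Omega$ with cells $\Omega_j$. Let $\mathbf{P}^p$ be a fixed finite-dimensional space of polynomials in $\mathbf{z}$ containing the constants (in the intended scheme, the Serendipity space of order $p$), and $\mathcal{V}_h^p=\{v: v|_{K_j}\in\mathbf{P}^p\ \forall K_j\in\mathcal{T}\}$. $\mathcal{X}_h^p$ is the restriction of $\mathcal{V}_h^p$ to configuration space (piecewise polynomials in $\mathbf{x}$ on $\mathcal{T}_\Omega$). On a face of a cell, superscript $-$ (resp. $+$) denotes the trace from just inside (resp. just outside) the cell. Vlasov part. For each species $s$ with charge $q_s$ and mass $m_s>0$, $f_{s,h}(t,\cdot)\in\mathcal{V}_h^p$ is differentiable in $t$ and satisfies, for all cells $K_j$ and all $w\in\mathcal{V}_h^p$, $$\int_{K_j}w\,\partial_t f_{s,h}\,d\mathbf{z}+\oint_{\partial K_j}w^-\,\mathbf{n}\cdot\hat{\mathbf{F}}\,dS-\int_{K_j}\nabla_{\mathbf{z}}w\cdot\boldsymbol{\alpha}_{s,h}f_{s,h}\,d\mathbf{z}=0,$$ where $\boldsymbol{\alpha}_{s,h}=\big(\mathbf{v},\tfrac{q_s}{m_s}(\mathbf{E}_h+\mathbf{v}\times\mathbf{B}_h)\big)$,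 $\mathbf{n}$ is the outward unit normal of $K_j$, and $\mathbf{n}\cdot\hat{\mathbf{F}}$ is the local Lax–Friedrichs flux $$\mathbf{n}\cdot\hat{\mathbf{F}}=\tfrac12\mathbf{n}\cdot(\boldsymbol{\alpha}_{s,h}^+f_{s,h}^++\boldsymbol{\alpha}_{s,h}^-f_{s,h}^-)-\tfrac{\lambda}{2}(f_{s,h}^+-f_{s,h}^-),\qquad \lambda=\max(|\mathbf{n}\cdot\boldsymbol{\alpha}_{s,h}^+|,|\mathbf{n}\cdot\boldsymbol{\alpha}_{s,h}^-|).$$ Maxwell part. $\mathbf{E}_h,\mathbf{B}_h$ have components in $\mathcal{X}_h^p$, are differentiable in $t$, and satisfy for all $\Omega_j$ and all $\varphi\in\mathcal{X}_h^p$ $$\int_{\Omega_j}\varphi\,\partial_t\mathbf{B}_h\,d\mathbf{x}+\oint_{\partial\Omega_j}d\mathbf{s}\times(\varphi^-\hat{\mathbf{E}}_h)-\int_{\Omega_j}\nabla\varphi\times\mathbf{E}_h\,d\mathbf{x}=0,$$ $$\epsilon_0\mu_0\int_{\Omega_j}\varphi\,\partial_t\mathbf{E}_h\,d\mathbf{x}-\oint_{\partial\Omega_j}d\mathbf{s}\times(\varphi^-\hat{\mathbf{B}}_h)+\int_{\Omega_j}\nabla\varphi\times\mathbf{B}_h\,d\mathbf{x}=-\mu_0\int_{\Omega_j}\varphi\,\mathbf{J}_h\,d\mathbf{x},$$ where $d\mathbf{s}$ is the outward vector area element, $\epsilon_0,\mu_0>0$ are constants, and $\mathbf{J}_h$ is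 the $L^2(\Omega)$-projection onto $\mathcal{X}_h^p$ (componentwise) of $\sum_s q_s\int_V\mathbf{v}f_{s,h}\,d\mathbf{v}$. All integrals are evaluated exactly. Boundary conditions: $\Omega$ is periodic (so every configuration-space face is shared by two cells), and the numerical flux $\mathbf{n}\cdot\hat{\mathbf{F}}$ is zero on $\Omega\times\partial V$ (zero-flux conditions in velocity space). *)

(* Defs.v *)
From HB Require Import structures.
From mathcomp Require Import all_boot all_order all_algebra.
From mathcomp Require Import all_classical all_reals all_analysis.
(* The notations of mpoly clash with those of MathComp-Analysis. *)
From mathcomp Require Import -(notations) mpoly.

Set Implicit Arguments.
Unset Strict Implicit.
Unset Printing Implicit Defensive.

Import Order.TTheory GRing.Theory Num.Theory.
Import numFieldNormedType.Exports.
Local Open Scope classical_set_scope.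
Local Open Scope ring_scope.

Notation mvpoly R n := (mpoly n R).

Section Vectors.
Variable R : realType.

Definition dot n (u v : 'rV[R]_n) : R := \sum_i u 0 i * v 0 i.

(* Indices are taken modulo 3: 'I_3 carries the ring structure of Z/3. *)
Definition cross (u v : 'rV[R]_3) : 'rV[R]_3 :=
  \row_(i < 3) (u 0 (i + 1) * v 0 (i + 2%:R) - u 0 (i + 2%:R) * v 0 (i + 1)).

Definition peval n (p : mvpoly R n) (z : 'rV[R]_n) : R := meval (fun i => z 0 i) p.

Definition pgrad n (p : mvpoly R n) (z : 'rV[R]_n) : 'rV[R]_n :=
  \row_i peval (mderiv i p) z.

Definition insert n (d : 'I_n.+1) (c : R) (y : 'rV[R]_n) : 'rV[R]_n.+1 :=
  \row_i (if unlift d i is Some k then y 0 k else c).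

(* Integral over the box \prod_i [a i, b i], as an iterated Lebesgue integral.
   The integrands below are continuous on closed cells and faces, so by Fubini
   this is the integral for n-dimensional Lebesgue measure. *)
Fixpoint box_int n : ('I_n -> R) -> ('I_n -> R) -> ('rV[R]_n -> R) -> R :=
  match n with
  | 0 => fun _ _ g => g 0
  | n'.+1 => fun a b g =>
      \int[lebesgue_measure]_(c in `[a ord0, b ord0])
        box_int (fun i => a (lift ord0 i)) (fun i => b (lift ord0 i))
                (fun y => g (insert ord0 c y))
  end.

End Vectors.

(* Cartesian (tensor-product, possibly non-uniform) mesh of a box of R^n:
   direction i has ncells i cells, with breakpoints node i 0 < node i 1 < ... *)
Record mesh (R : realType) (n : nat) := Mesh {
  ncells : 'I_n -> nat;
  node : 'I_n -> nat -> R;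
  ncells_gt0 : forall i, (0 < ncells i)%N;
  node_lt : forall i k, (k < ncells i)%N -> node i k < node i k.+1 }.

Definition cell (R : realType) (n : nat) (M : mesh R n) :=
  {dffun forall i : 'I_n, 'I_(ncells M i)}.

Section Cells.
Variable R : realType.

Definition cell_lo n (M : mesh R n) (j : cell M) (i : 'I_n) : R := node M i (j i).
Definition cell_hi n (M : mesh R n) (j : cell M) (i : 'I_n) : R := node M i (j i).+1.

Definition in_cell n (M : mesh R n) (j : cell M) (x : 'rV[R]_n) : Prop :=
  forall i, cell_lo j i <= x 0 i <= cell_hi j i.

Definition cell_int n (M : mesh R n) (j : cell M) (g : 'rV[R]_n -> R) : R :=
  box_int (cell_lo j) (cell_hi j) g.

(* A face of a cell is given by its normal direction d and a side: up = true for
   the face with outward normal + e_d, up = false for - e_d. *)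
Definition normal n (d : 'I_n) (up : bool) : 'rV[R]_n :=
  (if up then 1 else - 1) *: delta_mx 0 d.

Definition face_coord n (M : mesh R n) (j : cell M) (d : 'I_n) (up : bool) : R :=
  if up then cell_hi j d else cell_lo j d.

Definition face_int n (M : mesh R n.+1) (j : cell M) (d : 'I_n.+1) (up : bool)
    (g : 'rV[R]_n.+1 -> R) : R :=
  box_int (fun i => cell_lo j (lift d i)) (fun i => cell_hi j (lift d i))
          (fun y => g (insert d (face_coord j d up) y)).

Definition boundary_int n (M : mesh R n.+1) (j : cell M)
    (g : 'I_n.+1 -> bool -> 'rV[R]_n.+1 -> R) : R :=
  \sum_d \sum_(up : bool) face_int j d up (g d up).

Definition vcell_int n (M : mesh R n) (j : cell M) (g : 'rV[R]_n -> 'rV[R]_3) :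
    'rV[R]_3 :=
  \row_i cell_int j (fun x => g x 0 i).

Definition vboundary_int n (M : mesh R n.+1) (j : cell M)
    (g : 'I_n.+1 -> bool -> 'rV[R]_n.+1 -> 'rV[R]_3) : 'rV[R]_3 :=
  \row_i boundary_int j (fun d up x => g d up x 0 i).

(* The cell sharing the face (d, up) of j; ordS and ord_pred are cyclic, so the
   first and last cells of each direction are neighbours of each other. *)
Definition neighbour n (M : mesh R n) (j : cell M) (d : 'I_n) (up : bool) : cell M :=
  [ffun i => if i == d then (if up then ordS (j i) else ord_pred (j i)) else j i].

(* The point x of the face (d, up) of j, seen from the neighbour: its d-th
   coordinate is that of the opposite face of the neighbour.  The coordinate only
   changes when the face lies on the (periodically identified) boundary. *)
Definition across n (M : mesh R n) (j : cell M) (d : 'I_n) (up : bool)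
    (x : 'rV[R]_n) : 'rV[R]_n :=
  \row_i (if i == d then face_coord (neighbour j d up) d (~~ up) else x 0 i).

Definition on_boundary n (M : mesh R n) (k : cell M) (d : 'I_n) (up : bool) : bool :=
  if up then (k d).+1 == ncells M d else k d == 0%N :> nat.

End Cells.

Section Spaces.
Variable R : realType.

Definition in_span n N (b : N.-tuple (mvpoly R n)) (p : mvpoly R n) : Prop :=
  exists c : 'I_N -> R, p = \sum_i c i *: tnth b i.

Variables (MO MV : mesh R 3).

(* A piecewise polynomial is given by its polynomial on each cell, so that it has
   one trace from each side of a face. *)
Definition phase_fun := cell MO -> cell MV -> mvpoly R (3 + 3).
Definition config_fun := cell MO -> mvpoly R 3.
Definition config_vfield := 'I_3 -> config_fun.

(* b spans the local polynomial space P^p. *)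
Variables (N : nat) (b : N.-tuple (mvpoly R (3 + 3))).

Definition in_Vh (w : phase_fun) : Prop := forall j k, in_span b (w j k).

Definition lift_config (p : mvpoly R 3) : mvpoly R (3 + 3) :=
  comp_mpoly [tuple mpolyX R (mnm1 (lshift 3 i)) | i < 3] p.

(* phi belongs to X_h when (x, v) |-> phi x belongs to V_h.  If P^p is spanned by
   monomials, these are also the restrictions w(., 0) of the w in V_h. *)
Definition in_Xh (phi : config_fun) : Prop :=
  in_Vh (fun j _ => lift_config (phi j)).

Definition speed_sq : mvpoly R (3 + 3) :=
  \sum_(i < 3) mpolyX R (mnm1 (rshift 3 i)) ^+ 2.

Definition veval (F : config_vfield) (j : cell MO) (x : 'rV[R]_3) : 'rV[R]_3 :=
  \row_i peval (F i j) x.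

Definition phase_int (j : cell MO) (k : cell MV) (g : 'rV[R]_3 -> 'rV[R]_3 -> R) : R :=
  cell_int j (fun x => cell_int k (g x)).

(* J is the L^2(Omega)-orthogonal projection of G onto X_h, componentwise. *)
Definition is_L2_projection (G : cell MO -> 'rV[R]_3 -> 'rV[R]_3)
    (J : config_vfield) : Prop :=
  (forall i, in_Xh (J i)) /\
  (forall phi, in_Xh phi ->
     \sum_j vcell_int j (fun x => peval (phi j) x *: veval J j x) =
     \sum_j vcell_int j (fun x => peval (phi j) x *: G j x)).

End Spaces.

Section Scheme.
Variables (R : realType) (MO MV : mesh R 3).
Variables (N : nat) (b : N.-tuple (mvpoly R (3 + 3))).

(* Local Lax-Friedrichs flux n . F^; m and p stand for superscripts - and +. *)
Definition lax_friedrichs n (nu am ap : 'rV[R]_n) (fm fp : R) : R :=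
  let lambda := Num.max `|dot nu ap| `|dot nu am| in
  dot nu (fp *: ap + fm *: am) / 2 - lambda / 2 * (fp - fm).

(* alpha_{s,h} at (x, v), with the trace of the fields taken from the cell j. *)
Definition alpha (q m : R) (E B : config_vfield MO) (j : cell MO)
    (x v : 'rV[R]_3) : 'rV[R]_(3 + 3) :=
  row_mx v ((q / m) *: (veval E j x + cross v (veval B j x))).

Definition flux_config (q m : R) (E B : config_vfield MO) (f : phase_fun MO MV)
    (j : cell MO) (k : cell MV) (d : 'I_3) (up : bool) (x v : 'rV[R]_3) : R :=
  let j' := neighbour j d up in
  let x' := across j d up x in
  lax_friedrichs (row_mx (normal R d up) 0)
    (alpha q m E B j x v) (alpha q m E B j' x' v)
    (peval (f j k) (row_mx x v)) (peval (f j' k) (row_mx x' v)).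

(* Zero on the boundary of V; elsewhere across k d up v = v. *)
Definition flux_velocity (q m : R) (E B : config_vfield MO) (f : phase_fun MO MV)
    (j : cell MO) (k : cell MV) (d : 'I_3) (up : bool) (x v : 'rV[R]_3) : R :=
  if on_boundary k d up then 0 else
  let k' := neighbour k d up in
  let v' := across k d up v in
  lax_friedrichs (row_mx 0 (normal R d up))
    (alpha q m E B j x v) (alpha q m E B j x v')
    (peval (f j k) (row_mx x v)) (peval (f j k') (row_mx x v')).

(* The two boundary terms are over the two parts of the boundary of the cell
   Omega_j x V_k: (boundary of Omega_j) x V_k and Omega_j x (boundary of V_k). *)
Definition vlasov_eq (q m : R) (E B : R -> config_vfield MO)
    (f : R -> phase_fun MO MV) (t : R) : Prop :=
  forall (w : phase_fun MO MV), in_Vh b w -> forall j k,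
    phase_int j k (fun x v =>
      let z := row_mx x v in
      peval (w j k) z * derive1 (fun tau => peval (f tau j k) z) t)
    + (boundary_int j (fun d up x => cell_int k (fun v =>
         peval (w j k) (row_mx x v) * flux_config q m (E t) (B t) (f t) j k d up x v))
       + cell_int j (fun x => boundary_int k (fun d up v =>
         peval (w j k) (row_mx x v) * flux_velocity q m (E t) (B t) (f t) j k d up x v)))
    - phase_int j k (fun x v =>
        let z := row_mx x v in
        dot (pgrad (w j k) z) (alpha q m (E t) (B t) j x v) * peval (f t j k) z)
    = 0.

Definition central_flux (F : config_vfield MO) (j : cell MO) (d : 'I_3) (up : bool)
    (x : 'rV[R]_3) : 'rV[R]_3 :=
  2^-1 *: (veval F (neighbour j d up) (across j d up x) + veval F j x).

Definition time_deriv (F : R -> config_vfield MO) (t : R) (j : cell MO)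
    (x : 'rV[R]_3) : 'rV[R]_3 :=
  \row_i derive1 (fun tau => peval (F tau i j) x) t.

Definition faraday_eq (E B : R -> config_vfield MO) (t : R) : Prop :=
  forall phi, in_Xh MV b phi -> forall j,
    vcell_int j (fun x => peval (phi j) x *: time_deriv B t j x)
    + vboundary_int j (fun d up x =>
        cross (normal R d up) (peval (phi j) x *: central_flux (E t) j d up x))
    - vcell_int j (fun x => cross (pgrad (phi j) x) (veval (E t) j x))
    = 0.

Definition ampere_eq (eps0 mu0 : R) (E B J : R -> config_vfield MO) (t : R) : Prop :=
  forall phi, in_Xh MV b phi -> forall j,
    (eps0 * mu0) *: vcell_int j (fun x => peval (phi j) x *: time_deriv E t j x)
    - vboundary_int j (fun d up x =>
        cross (normal R d up) (peval (phi j) x *: central_flux (B t) j d up x))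
    + vcell_int j (fun x => cross (pgrad (phi j) x) (veval (B t) j x))
    = - mu0 *: vcell_int j (fun x => peval (phi j) x *: veval (J t) j x).

(* \sum_s q_s \int_V v f_s dv at the point x of the cell j. *)
Definition current (S : finType) (q : S -> R) (f : S -> phase_fun MO MV)
    (j : cell MO) (x : 'rV[R]_3) : 'rV[R]_3 :=
  \sum_s q s *: \sum_k vcell_int k (fun v => peval (f s j k) (row_mx x v) *: v).

Record dg_solution (S : finType) (q m : S -> R) (eps0 mu0 : R) (T : set R)
    (f : S -> R -> phase_fun MO MV) (E B J : R -> config_vfield MO) : Prop := {
  dg_f_in : forall s t, T t -> in_Vh b (f s t);
  dg_f_diff : forall s t, T t -> forall j k x v, in_cell j x -> in_cell k v ->
    derivable (fun tau => peval (f s tau j k) (row_mx x v)) t 1;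
  dg_E_in : forall t, T t -> forall i, in_Xh MV b (E t i);
  dg_B_in : forall t, T t -> forall i, in_Xh MV b (B t i);
  dg_E_diff : forall t, T t -> forall i j x, in_cell j x ->
    derivable (fun tau => peval (E tau i j) x) t 1;
  dg_B_diff : forall t, T t -> forall i j x, in_cell j x ->
    derivable (fun tau => peval (B tau i j) x) t 1;
  dg_J : forall t, T t ->
    is_L2_projection MV b (current q (fun s => f s t)) (J t);
  dg_vlasov : forall s t, T t -> vlasov_eq (q s) (m s) E B (f s) t;
  dg_faraday : forall t, T t -> faraday_eq E B t;
  dg_ampere : forall t, T t -> ampere_eq eps0 mu0 E B J t }.

Definition particle_energy (S : finType) (m : S -> R) (f : S -> phase_fun MO MV) : R :=
  \sum_j \sum_k \sum_s phase_int j k (fun x v =>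
    2^-1 * m s * dot v v * peval (f s j k) (row_mx x v)).

Definition field_energy (eps0 mu0 : R) (E B : config_vfield MO) : R :=
  \sum_j cell_int j (fun x =>
    eps0 / 2 * dot (veval E j x) (veval E j x)
    + 1 / (2 * mu0) * dot (veval B j x) (veval B j x)).

End Scheme.

(* Main.v *)
(* Testing the Vlasov equation with |v|^2, which is continuous across faces and
   periodic in x, makes the antisymmetric numerical fluxes cancel in pairs; the
   magnetic force does no work, so only the work of E_h on the current remains.
   Since J_h is the L^2 projection of the current and E_h lies in X_h, this work
   equals the integral of E_h . J_h.  Testing Faraday's law with B_h and Ampere's
   law with E_h, the volume terms combine into div (E_h x B_h); with central
   fluxes, its boundary term and the numerical fluxes add up to a quantity that
   is antisymmetric in the two sides of a face, so the field loses exactly the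
   integral of E_h . J_h.
   To differentiate the energies in time, note that the solution stays in a
   finite-dimensional space of functions on each cell, hence is a finite sum of
   differentiable coefficients times fixed polynomials. *)
Require Import Defs.
From HB Require Import structures.
From mathcomp Require Import all_boot all_order all_algebra.
From mathcomp Require Import all_classical all_reals all_analysis.
From mathcomp Require Import -(notations) mpoly.
From mathcomp Require Import ring lra.
Import Order.TTheory GRing.Theory Num.Theory.
Import numFieldNormedType.Exports.
Local Open Scope classical_set_scope.
Local Open Scope ring_scope.

Set Implicit Arguments.
Unset Strict Implicit.
Unset Printing Implicit Defensive.

(** * Iterated integrals of continuous functions *)

Section BoxIntegral.
Variable R : realType.
Local Notation mu := (@lebesgue_measure R).

Lemma continuous_matrix (U : topologicalType) m n (F : U -> 'M[R]_(m, n)) :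
  (forall i j, continuous (fun u => F u i j)) -> continuous F.
Proof.
move=> cF u A [P nP sPA]; near=> v; apply: sPA; near: v.
by apply: filter_forall => i; apply: filter_forall => j; exact: cF (nP i j).
Unshelve. all: by end_near. Qed.

Lemma continuous_coord (U : topologicalType) m n (F : U -> 'M[R]_(m, n)) :
  continuous F -> forall i j, continuous (fun u => F u i j).
Proof.
move=> cF i j u; apply: (@continuous_comp _ _ _ F (fun M : 'M[R]_(m, n) => M i j)).
  exact: cF.
exact: coord_continuous.
Qed.

Lemma continuous_sum (U : topologicalType) (I : Type) (r : seq I) (P : pred I)
    (F : I -> U -> R) :
  (forall i, P i -> continuous (F i)) ->
  continuous (fun u => \sum_(i <- r | P i) F i u).
Proof. by apply: continuous_big; exact: add_continuous. Qed.

Lemma continuous_prod (U : topologicalType) (I : Type) (r : seq I) (P : pred I)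
    (F : I -> U -> R) :
  (forall i, P i -> continuous (F i)) ->
  continuous (fun u => \prod_(i <- r | P i) F i u).
Proof. by apply: continuous_big; exact: mul_continuous. Qed.

Lemma continuous_mul (U : topologicalType) (f g : U -> R) :
  continuous f -> continuous g -> continuous (fun u => f u * g u).
Proof. by move=> cf cg u; apply: cvgM; [exact: cf | exact: cg]. Qed.

Lemma continuous_add (U : topologicalType) (f g : U -> R) :
  continuous f -> continuous g -> continuous (fun u => f u + g u).
Proof. by move=> cf cg u; apply: cvgD; [exact: cf | exact: cg]. Qed.

Lemma continuous_opp (U : topologicalType) (f : U -> R) :
  continuous f -> continuous (fun u => - f u).
Proof. by move=> cf u; apply: cvgN; exact: cf. Qed.

Lemma continuous_cst (U V : topologicalType) (c : V) :
  continuous (fun _ : U => c).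
Proof. by move=> u; exact: cvg_cst. Qed.

Lemma continuous_peval (U : topologicalType) n (p : mvpoly R n) (Z : U -> 'rV[R]_n) :
  continuous Z -> continuous (fun u => peval p (Z u)).
Proof.
move=> cZ; rewrite /peval.
under eq_fun do rewrite mevalE.
apply: continuous_sum => m _; apply: continuous_mul; first exact: continuous_cst.
apply: continuous_prod => i _ u.
apply: (@continuous_comp _ _ _ (fun u => Z u 0 i) (fun x : R => x ^+ m i)).
  exact: continuous_coord.
exact: exprn_continuous.
Qed.

Lemma continuous_fst (U V : topologicalType) : continuous (@fst U V).
Proof. by move=> u; exact: cvg_fst. Qed.

Lemma continuous_snd (U V : topologicalType) : continuous (@snd U V).
Proof. by move=> u; exact: cvg_snd. Qed.

Lemma continuous_pairing (U V W : topologicalType) (f : U -> V) (g : U -> W) :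
  continuous f -> continuous g -> continuous (fun u => (f u, g u)).
Proof. by move=> cf cg u; apply: cvg_pair; [exact: cf|exact: cg]. Qed.

Lemma continuous_compose (U V W : topologicalType) (g : V -> W) (f : U -> V) :
  continuous g -> continuous f -> continuous (fun u => g (f u)).
Proof. by move=> cg cf u; apply: continuous_comp; [exact: cf|exact: cg]. Qed.

Lemma continuous_insert (U : topologicalType) n (d : 'I_n.+1) (c : U -> R)
    (y : U -> 'rV[R]_n) :
  continuous c -> continuous y -> continuous (fun u => insert d (c u) (y u)).
Proof.
move=> cc cy; apply: continuous_matrix => i j.
under eq_fun do rewrite mxE.
by case: unliftP => [k _|_]; [exact: continuous_coord | exact: cc].
Qed.

Lemma integrable_itv (a b : R) (f : R -> R) :
  continuous f -> mu.-integrable `[a, b] (EFin \o f).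
Proof.
move=> cf; apply: continuous_compact_integrable; first exact: segment_compact.
exact: continuous_subspaceT.
Qed.

(** Compactness of the segment makes [h u] uniformly close to [h u0] on it for [u] near [u0];
    integrating this bound gives continuity of the integral. *)
Lemma continuous_itv_integral (U : topologicalType) (a b : R) (h : U -> R -> R) :
  continuous (fun p : U * R => h p.1 p.2) ->
  continuous (fun u => \int[mu]_(c in `[a, b]) h u c).
Proof.
move=> ch u0.
have ch1 u : continuous (h u).
  apply: (continuous_compose ch (f := fun c => (u, c))).
  by apply: continuous_pairing; [exact: continuous_cst|move=> ?; exact: cvg_id].
apply/cvgrPdist_le => /= e e0.
(* The added 1 keeps [M] positive for a segment of length zero, and [e / M] times the length stays
   below [e]. *)
pose M := fine (mu `[a, b]) + 1.
have M0 : 0 < M by rewrite ltr_wpDl ?fine_ge0.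
have d0 : 0 < e / M by rewrite divr_gt0.
have close : \forall u \near u0, `[a, b]%classic `<=` (fun c => `|h u0 c - h u c| <= e / M).
  (* Closeness near each single point [(c, u0)] becomes uniform in [c] by compactness; the local
     bound passes through the value [h u0 c]. *)
  have /compact_near_coveringP cov := @segment_compact R a b.
  apply: (cov U (nbhs u0) (fun u c => `|h u0 c - h u c| <= e / M)) => c _.
  have half0 : 0 < e / M / 2 by rewrite divr_gt0.
  have csw : continuous (fun p : R * U => h p.2 p.1).
    apply: (continuous_compose ch (f := fun p : R * U => (p.2, p.1))).
    by apply: continuous_pairing; [exact: continuous_snd|exact: continuous_fst].
  have /cvgrPdist_le /(_ _ half0) /= c3 := csw (c, u0).
  have /cvgrPdist_le /(_ _ half0) /= c2 := ch1 u0 c.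
  have c4 : \forall p \near (c, u0), `|h u0 c - h u0 p.1| <= e / M / 2.
    by have := @continuous_fst _ _ (c, u0) _ c2.
  near=> p => /=; rewrite -(subrKA (h u0 c)) (splitr (e / M)).
  apply: le_trans (ler_normD _ _) _; rewrite distrC lerD //; near: p.
    exact: c4.
  exact: c3.
near=> u.
have intD : mu.-integrable `[a, b] (EFin \o (fun c => h u0 c - h u c)).
  by apply: integrable_itv; apply: continuous_add => //; exact: continuous_opp.
rewrite -RintegralB //; [|exact: integrable_itv..].
apply: le_trans (le_normr_Rintegral _ _) _ => //.
apply: (@le_trans _ _ (\int[mu]_(c in `[a, b]) (e / M))).
  apply: le_Rintegral => //.
  - apply: integrable_itv => c.
    apply: (@continuous_comp _ _ _ (fun c => h u0 c - h u c) Num.norm); last exact: norm_continuous.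
    by apply: continuous_add => //; exact: continuous_opp.
  - by apply: integrable_itv; exact: continuous_cst.
  - by move=> c; apply: (near close u).
rewrite Rintegral_cst //= mulrAC ler_pdivrMr // ler_pM2l // lerDl //.
Unshelve. all: by end_near. Qed.

(* The parameter space [U] absorbs the outer variables in the induction. *)
Lemma continuous_box_int n : forall (U : topologicalType) (a b : 'I_n -> R)
    (g : U -> 'rV[R]_n -> R),
  continuous (fun p : U * 'rV[R]_n => g p.1 p.2) ->
  continuous (fun u => box_int a b (g u)).
Proof.
elim: n => [|n IH] U a b g cg /=.
  apply: (@continuous_compose _ _ _ _ (fun u => (u, 0 : 'rV[R]_0)) cg).
  by apply: continuous_pairing; [move=> ?; exact: cvg_id|exact: continuous_cst].
apply: (@continuous_itv_integral U _ _ (fun u c => box_int _ _ (fun y => g u (insert ord0 c y)))).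
apply: (IH (U * R)%type _ _ (fun p y => g p.1 (insert ord0 p.2 y))).
apply: (continuous_compose cg (f := fun p : U * R * 'rV[R]_n => (p.1.1, insert ord0 p.1.2 p.2))).
have c1 := @continuous_fst (U * R)%type 'rV[R]_n.
apply: continuous_pairing.
  by apply: continuous_compose c1; exact: continuous_fst.
apply: continuous_insert; last exact: continuous_snd.
by apply: continuous_compose c1; exact: continuous_snd.
Qed.

Definition in_box n (a b : 'I_n -> R) (y : 'rV[R]_n) : Prop :=
  forall i, a i <= y 0 i <= b i.

Lemma insertE n (d : 'I_n.+1) (c : R) (y : 'rV[R]_n) :
  (insert d c y 0 d = c) * (forall k, insert d c y 0 (lift d k) = y 0 k).
Proof.
by split => [|k]; rewrite mxE; [rewrite unlift_none | rewrite liftK].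
Qed.

Lemma in_box_insert n (a b : 'I_n.+1 -> R) d c (y : 'rV[R]_n) :
  a d <= c <= b d -> in_box (fun i => a (lift d i)) (fun i => b (lift d i)) y ->
  in_box a b (insert d c y).
Proof.
by move=> hc hy i; case: (unliftP d i) => [k|] ->; rewrite insertE.
Qed.

(** Time derivatives of the solution are only controlled at points of closed cells, so integrands
    are compared there alone. *)
Lemma eq_box_int n (a b : 'I_n -> R) (g h : 'rV[R]_n -> R) :
  (forall y, in_box a b y -> g y = h y) -> box_int a b g = box_int a b h.
Proof.
elim: n a b g h => [|n IH] a b g h gh /=; first by apply: gh => -[].
apply: eq_Rintegral => c; rewrite inE /= in_itv /= => hc.
by apply: IH => y hy; apply: gh; exact: in_box_insert.
Qed.

(* No integrability is needed: if the positive and negative parts both have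
   infinite integral, both sides are the junk value 0. *)
Lemma Rintegral_opp (A : set R) (f : R -> R) :
  \int[mu]_(x in A) - f x = - \int[mu]_(x in A) f x.
Proof.
rewrite /Rintegral.
under eq_integral do rewrite EFinN.
rewrite [in LHS]integralE [in RHS]integralE funeposN funenegN.
have : (0 <= \int[mu]_(x in A) (fun x => (f x)%:E)^\+%E x)%E by exact: integral_ge0.
have : (0 <= \int[mu]_(x in A) (fun x => (f x)%:E)^\-%E x)%E by exact: integral_ge0.
by move: (integral _ _ _) (integral _ _ _) => [x| |] [y| |] //= _ _;
  rewrite ?oppr0 // opprB.
Qed.

Lemma box_intN n (a b : 'I_n -> R) (g : 'rV[R]_n -> R) :
  box_int a b (fun y => - g y) = - box_int a b g.
Proof.
elim: n a b g => [//|n IH] a b g /=.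
rewrite -Rintegral_opp; apply: eq_Rintegral => c _; exact: IH.
Qed.

Lemma continuous_box_slice n (a b : 'I_n.+1 -> R) (g : 'rV[R]_n.+1 -> R) :
  continuous g ->
  continuous (fun c => box_int (fun i => a (lift ord0 i)) (fun i => b (lift ord0 i))
                         (fun y => g (insert ord0 c y))).
Proof.
move=> cg; apply: (continuous_box_int (g := fun c y => g (insert ord0 c y))).
apply: continuous_compose cg _; apply: continuous_insert.
  exact: continuous_fst.
exact: continuous_snd.
Qed.

Lemma continuous_slice n (d : 'I_n.+1) c (g : 'rV[R]_n.+1 -> R) :
  continuous g -> continuous (fun y => g (insert d c y)).
Proof.
move=> cg; apply: continuous_compose cg _; apply: continuous_insert.
  exact: continuous_cst.
by move=> ?; exact: cvg_id.
Qed.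

Lemma box_intD n (a b : 'I_n -> R) (g h : 'rV[R]_n -> R) :
  continuous g -> continuous h ->
  box_int a b (fun y => g y + h y) = box_int a b g + box_int a b h.
Proof.
elim: n a b g h => [//|n IH] a b g h cg ch /=.
rewrite -RintegralD //; last 2 first.
- by apply: integrable_itv; exact: continuous_box_slice.
- by apply: integrable_itv; exact: continuous_box_slice.
by apply: eq_Rintegral => c _; apply: IH; exact: continuous_slice.
Qed.

Lemma box_intZ n (a b : 'I_n -> R) (r : R) (g : 'rV[R]_n -> R) :
  continuous g -> box_int a b (fun y => r * g y) = r * box_int a b g.
Proof.
elim: n a b g => [//|n IH] a b g cg /=.
rewrite -RintegralZl //; last first.
  by apply: integrable_itv; exact: continuous_box_slice.
by apply: eq_Rintegral => c _; apply: IH; exact: continuous_slice.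
Qed.

(** This integral equals its own opposite. *)
Lemma box_int0 n (a b : 'I_n -> R) : box_int a b (fun _ : 'rV[R]_n => 0) = 0.
Proof.
have := box_intN a b (fun _ : 'rV[R]_n => 0).
rewrite (@eq_box_int _ _ _ _ (fun=> 0)) => [|y _]; last exact: oppr0.
by move/eqP; rewrite -addr_eq0 -mulr2n mulrn_eq0 /= => /eqP.
Qed.

Lemma box_int_sum n (a b : 'I_n -> R) (I : Type) (r : seq I) (P : pred I)
    (F : I -> 'rV[R]_n -> R) :
  (forall i, P i -> continuous (F i)) ->
  box_int a b (fun y => \sum_(i <- r | P i) F i y) =
  \sum_(i <- r | P i) box_int a b (F i).
Proof.
move=> cF; elim: r => [|i r IH].
  rewrite big_nil -[RHS](box_int0 a b).
  by apply: eq_box_int => y _; rewrite big_nil.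
rewrite big_cons; case: ifPn => Pi; last first.
  by rewrite -IH; apply: eq_box_int => y _; rewrite big_cons (negPf Pi).
rewrite -IH -box_intD; [|exact: cF|exact: continuous_sum].
by apply: eq_box_int => y _; rewrite big_cons Pi.
Qed.

(** In the iterated integral, the factors in the remaining variables are constant with respect to
    the first one and come out of its integral. *)
Lemma box_int_prod n (a b : 'I_n -> R) (h : 'I_n -> R -> R) :
  (forall i, continuous (h i)) ->
  box_int a b (fun y => \prod_i h i (y 0 i)) =
  \prod_i \int[mu]_(c in `[a i, b i]) h i c.
Proof.
elim: n a b h => [|n IH] a b h ch /=; first by rewrite !big_ord0.
rewrite big_ord_recl -RintegralZr //; last exact: integrable_itv.
apply: eq_Rintegral => c _; rewrite -IH -?box_intZ //.
  by apply: eq_box_int => y _; rewrite big_ord_recl insertE;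
    congr (_ * _); apply: eq_bigr => i _; rewrite insertE.
apply: continuous_prod => i _; apply: continuous_compose (ch _) _.
exact: coord_continuous.
Qed.

(** The integrand has the shape of a formal derivative of a monomial. For [k = 0] the truncated
    exponent is harmless: the coefficient is zero and both sides vanish. *)
Lemma integral_itv_monomial (a b : R) k : a < b ->
  \int[mu]_(c in `[a, b]) (k%:R * c ^+ k.-1) = b ^+ k - a ^+ k.
Proof.
move=> ab; rewrite /Rintegral.
rewrite (@continuous_FTC2 _ _ (fun c => c ^+ k)) //.
- apply: continuous_subspaceT; apply: continuous_mul; first exact: continuous_cst.
  exact: exprn_continuous.
- split.
  + by move=> x _; exact: exprn_derivable.
  + by apply: cvg_at_right_filter; exact: exprn_continuous.
  + by apply: cvg_at_left_filter; exact: exprn_continuous.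
- by move=> x _; exact: exp_derive1.
Qed.

End BoxIntegral.

(* Otherwise unification unfolds the integrals at dimension 3 and diverges. *)
#[local] Opaque box_int.

(** * Polynomials on boxes *)

Section Polynomials.
Variable R : realType.
Local Notation mu := (@lebesgue_measure R).

Lemma pevalD n (p q : mvpoly R n) z : peval (p + q) z = peval p z + peval q z.
Proof. exact: mevalD. Qed.

Lemma pevalB n (p q : mvpoly R n) z : peval (p - q) z = peval p z - peval q z.
Proof. exact: mevalB. Qed.

Lemma pevalZ n c (p : mvpoly R n) z : peval (c *: p) z = c * peval p z.
Proof. exact: mevalZ. Qed.

Lemma pevalM n (p q : mvpoly R n) z : peval (p * q) z = peval p z * peval q z.
Proof. exact: mevalM. Qed.

Lemma peval_sum n (I : Type) (r : seq I) (P : pred I) (F : I -> mvpoly R n) z :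
  peval (\sum_(i <- r | P i) F i) z = \sum_(i <- r | P i) peval (F i) z.
Proof. exact: raddf_sum. Qed.

Lemma peval_continuous n (p : mvpoly R n) : continuous (peval p).
Proof. by apply: continuous_peval => ?; exact: cvg_id. Qed.

(* On monomials the iterated integral factors into one-dimensional ones, so no
   exchange of the order of integration is needed. *)
Lemma box_int_mderiv n (p : mvpoly R n.+1) d (a b : 'I_n.+1 -> R) : a d < b d ->
  box_int a b (peval (mderiv d p)) =
  box_int (fun i => a (lift d i)) (fun i => b (lift d i))
    (fun y => peval p (insert d (b d) y)) -
  box_int (fun i => a (lift d i)) (fun i => b (lift d i))
    (fun y => peval p (insert d (a d) y)).
Proof.
move=> ab.
have sliceC (q : mvpoly R n.+1) c : continuous (fun y => peval q (insert d c y)).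
  exact: (@continuous_slice R n d c (peval q) (@peval_continuous _ q)).
elim/mpolyind: p => [|c m p _ _ IH].
  rewrite raddf0.
  have e k (a' b' : 'I_k -> R) (g : 'rV_k -> R) : (forall y, g y = 0) -> box_int a' b' g = 0.
    by move=> g0; rewrite -[RHS](box_int0 a' b'); apply: eq_box_int => y _.
  by rewrite !e ?subr0 // => y; exact: meval0.
(* On the slice at height [e] a monomial is [e ^+ m d] times a factor independent of [e], so the
   difference of the two slices only sees the exponent in direction [d]. *)
have slice e : box_int (fun i => a (lift d i)) (fun i => b (lift d i))
    (fun y => peval (c *: mpolyX R m + p) (insert d e y)) =
    c * (e ^+ m d * \prod_i \int[mu]_(x in `[a (lift d i), b (lift d i)]) (x ^+ m (lift d i)))
    + box_int (fun i => a (lift d i)) (fun i => b (lift d i)) (fun y => peval p (insert d e y)).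
  under eq_box_int do rewrite pevalD pevalZ.
  have cX := sliceC (mpolyX R m) e.
  rewrite box_intD //; last by apply: continuous_mul => //; exact: continuous_cst.
  rewrite box_intZ //; congr (_ * _ + _).
  have cP : continuous (fun y : 'rV[R]_n => \prod_i y 0 i ^+ m (lift d i)).
    apply: continuous_prod => i _.
    apply: (continuous_compose (@exprn_continuous _ _)); exact: coord_continuous.
  rewrite -(box_int_prod _ _ (h := fun i x => x ^+ m (lift d i))).
    rewrite -box_intZ //; apply: eq_box_int => y _.
    rewrite /peval mevalX (bigD1_ord d) //= insertE; congr (_ * _).
    by apply: eq_bigr => i _; rewrite insertE.
  by move=> i; exact: exprn_continuous.
rewrite !slice linearD linearZ /=.
under eq_box_int do rewrite pevalD pevalZ mderivX pevalZ.
have cX (q : mvpoly R n.+1) : continuous (peval q) := @peval_continuous _ q.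
rewrite box_intD //; last first.
  by do 2 (apply: continuous_mul; first exact: continuous_cst).
rewrite IH !box_intZ //; last first.
  by apply: continuous_mul => //; exact: continuous_cst.
(* Differentiation leaves the exponents in the other directions unchanged, so both sides share those
   integrals; direction [d] is the one-dimensional fundamental theorem of calculus. *)
suff -> : (m d)%:R * box_int a b (peval (mpolyX R (mnm_sub m (mnm1 d)))) =
    (b d ^+ m d - a d ^+ m d) *
    \prod_i \int[mu]_(x in `[a (lift d i), b (lift d i)]) (x ^+ m (lift d i)) by ring.
rewrite -integral_itv_monomial //.
rewrite RintegralZl //; last by apply: integrable_itv; exact: exprn_continuous.
rewrite -mulrA; congr (_ * _).
transitivity (box_int a b (fun y => \prod_i y 0 i ^+ (mnm_sub m (mnm1 d)) i)).
  by apply: eq_box_int => y _; rewrite /peval mevalX.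
rewrite (box_int_prod _ _ (h := fun i x => x ^+ (mnm_sub m (mnm1 d)) i)); last first.
  by move=> i; exact: exprn_continuous.
rewrite (bigD1_ord d) //= mnmBE mnm1E eqxx subn1; congr (_ * _).
by apply: eq_bigr => i _; rewrite mnmBE mnm1E (negPf (neq_lift _ _)) subn0.
Qed.

(* No linear independence on [X] is needed: a basis polynomial that depends on the
   previous ones on [X] contributes no node. *)
Lemma nodal_representation n N (b : N.-tuple (mvpoly R n)) (X : set 'rV[R]_n) :
  exists (r : nat) (z : 'I_r -> 'rV[R]_n) (L : 'I_r -> mvpoly R n),
    (forall l, X (z l)) /\
    forall p, in_span b p -> forall y, X y ->
      peval p y = \sum_l peval p (z l) * peval (L l) y.
Proof.
suff [s sX sE] : exists2 s : seq ('rV[R]_n * mvpoly R n), {in s, forall zL, X zL.1} &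
    forall p, in_span b p -> forall y, X y ->
      peval p y = \sum_(zL <- s) peval p zL.1 * peval zL.2 y.
  exists (size s), (fun l => (tnth (in_tuple s) l).1), (fun l => (tnth (in_tuple s) l).2).
  split=> [l|p pb y Xy]; first by apply: sX; exact: mem_tnth.
  by rewrite (sE p pb y Xy) big_tnth.
elim: N b => [|N IH] b.
  by exists [::] => // p [c ->] y _; rewrite big_ord0 big_nil; exact: meval0.
case/tupleP: b => phi t; have [s sX sE] := IH t.
have split_span p : in_span [tuple of phi :: t] p ->
    exists c q, in_span t q /\ p = c *: phi + q.
  case=> c ->; exists (c ord0), (\sum_i c (lift ord0 i) *: tnth t i); split.
    by exists (fun i => c (lift ord0 i)).
  by rewrite big_ord_recl tnth0; congr (_ + _); apply: eq_bigr => i _; rewrite tnthS.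
(* [psi] is the error made on the new polynomial [phi] by interpolation at the nodes already found.
   Interpolation is exact on the span of [t], so every error on the larger span is a multiple of
   [psi]. *)
pose psi := phi - \sum_(zL <- s) peval phi zL.1 *: zL.2.
have residual c q y : in_span t q -> X y ->
    peval (c *: phi + q) y =
    \sum_(zL <- s) peval (c *: phi + q) zL.1 * peval zL.2 y + c * peval psi y.
  move=> qt Xy; rewrite pevalD pevalZ (sE q qt y Xy) /psi pevalB peval_sum.
  under [X in _ = X + _]eq_bigr do rewrite pevalD pevalZ mulrDl -mulrA.
  rewrite big_split /= -mulr_sumr.
  under [X in _ = _ + _ * (_ - X)]eq_bigr do rewrite pevalZ.
  ring.
have [[x [Xx psix]]|psi0] := pselect (exists x, X x /\ peval psi x != 0).
(* A point where [psi] does not vanish becomes a new node. Its polynomial is [psi] normalised to 1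
   there, and the old ones are corrected by a multiple of [psi] so as to vanish there. *)
- exists ((x, (peval psi x)^-1 *: psi) ::
    [seq (zL.1, zL.2 - (peval zL.2 x / peval psi x) *: psi) | zL <- s]).
    move=> zL; rewrite in_cons => /orP[/eqP -> //|/mapP[w ws ->]]; exact: (sX w ws).
  move=> p /split_span[c [q [qt ->]]] y Xy.
  rewrite big_cons big_map /=.
  under [X in _ = _ + X]eq_bigr do rewrite pevalB pevalZ mulrBr.
  rewrite sumrB {1}(residual _ _ _ qt Xy) {1}(residual _ _ _ qt Xx) pevalZ.
  have -> : \sum_(zL <- s) peval (c *: phi + q) zL.1 * (peval zL.2 x / peval psi x * peval psi y) =
    (\sum_(zL <- s) peval (c *: phi + q) zL.1 * peval zL.2 x) * (peval psi y / peval psi x).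
    by rewrite mulr_suml; apply: eq_bigr => zL _; ring.
  by field.
- exists s => // p /split_span[c [q [qt ->]]] y Xy.
  rewrite (residual _ _ _ qt Xy); suff -> : peval psi y = 0 by rewrite mulr0 addr0.
  by apply/eqP/negPn/negP => psiy; apply: psi0; exists y.
Qed.

End Polynomials.

(** * Time derivatives of integrals *)

Section Separation.
Variables (R : realType) (A : topologicalType).
Implicit Types (X : set A) (t : R) (F G : R -> A -> R).

(** The two properties of an integral that differentiation in time relies on. Cell integrals and
    phase-space integrals both have them, so the time derivatives are computed once for both. *)
Definition integral_on X (I : (A -> R) -> R) : Prop :=
  (forall g h, (forall y, X y -> g y = h y) -> I g = I h) /\
  (forall (K : finType) (c : K -> R) (phi : K -> A -> R),
     (forall k, continuous (phi k)) ->
     I (fun y => \sum_k c k * phi k y) = \sum_k c k * I (phi k)).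

(* A solution of the scheme stays in a finite-dimensional space, so on a cell it
   separates into time-dependent coefficients and fixed continuous functions. *)
Definition separated X t F : Prop :=
  exists (K : finType) (c : K -> R -> R) (phi : K -> A -> R),
  [/\ forall k, derivable (c k) t 1, forall k, continuous (phi k) &
      \forall tau \near t, forall y, X y -> F tau y = \sum_k c k tau * phi k y].

Lemma separated_cst X t (g : A -> R) : continuous g -> separated X t (fun _ => g).
Proof.
move=> cg; exists 'I_1, (fun _ _ => 1), (fun _ => g); split => //.
by near=> tau => y _; rewrite big_ord1 mul1r.
Unshelve. all: by end_near. Qed.

Lemma separatedM X t F G : separated X t F -> separated X t G ->
  separated X t (fun tau y => F tau y * G tau y).
Proof.
move=> [K [c [phi [dc cphi FE]]]] [L [e [psi [de cpsi GE]]]].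
exists (K * L)%type, (fun k tau => c k.1 tau * e k.2 tau),
  (fun k y => phi k.1 y * psi k.2 y); split => [k|k|].
- exact: derivableM.
- exact: continuous_mul.
near=> tau => y Xy.
rewrite (near FE tau _ y Xy) // (near GE tau _ y Xy) // big_distrlr /= pair_bigA /=.
by apply: eq_bigr => k _; ring.
Unshelve. all: by end_near. Qed.

(** Differentiation falls on finitely many scalar coefficients, so it commutes with any [I] linear
    on finite combinations. The same [D] serves pointwise and under every such [I]. *)
Lemma separated_derive X t F : separated X t F ->
  exists D : A -> R, [/\ continuous D,
    forall y, X y -> is_derive t 1 (fun tau => F tau y) (D y) &
    forall I, integral_on X I -> is_derive t 1 (fun tau => I (F tau)) (I D)].
Proof.
move=> [K [c [phi [dc cphi FE]]]].
have dsum (w : K -> R) : is_derive t (1 : R) (fun tau => \sum_k c k tau * w k)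
    (\sum_k 'D_1 (c k) t * w k).
  have -> : (fun tau => \sum_k c k tau * w k) = \sum_k (w k \*: c k).
    by apply/funext => tau; rewrite fct_sumE; apply: eq_bigr => k _; rewrite mulrC.
  elim/big_ind2 : _ => [|f df g dg hf hg|k _].
  - exact: is_derive_cst.
  - exact: is_deriveD.
  - by rewrite mulrC; apply: is_deriveZ; exact: derivableP.
exists (fun y => \sum_k 'D_1 (c k) t * phi k y); split.
- apply: continuous_sum => k _; apply: continuous_mul => //; exact: continuous_cst.
- move=> y Xy; apply: near_eq_is_derive (dsum (phi ^~ y)).
  by near=> tau; rewrite (near FE tau _ y Xy).
- move=> I [I_eq I_lin]; rewrite I_lin //.
  apply: near_eq_is_derive (dsum (fun k => I (phi k))).
  near=> tau; rewrite -I_lin //; apply: I_eq => y Xy.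
  by rewrite (near FE tau _ y Xy).
Unshelve. all: by end_near. Qed.

(** The coefficients are the values of [p tau] at nodes chosen in the image of [X], where
    differentiability in time is assumed. Since [T] is open, [p tau] stays in the span for all [tau]
    near [t]. *)
Lemma separated_peval n N (b : N.-tuple (mvpoly R n)) (T : set R) X t
    (p : R -> mvpoly R n) (Z : A -> 'rV[R]_n) :
  open T -> T t -> continuous Z ->
  (forall tau, T tau -> in_span b (p tau)) ->
  (forall y, X y -> derivable (fun tau => peval (p tau) (Z y)) t 1) ->
  separated X t (fun tau y => peval (p tau) (Z y)).
Proof.
move=> oT Tt cZ pb dp.
have [r [z [L [zX E]]]] := nodal_representation b (Z @` X).
exists 'I_r, (fun l tau => peval (p tau) (z l)), (fun l y => peval (L l) (Z y)).
split => [l|l|].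
- by have [y Xy <-] := zX l; exact: dp.
- exact: continuous_peval.
have nT : \forall tau \near t, T tau by exact: open_nbhs_nbhs.
near=> tau => y Xy; apply: E; last by exists y.
by apply: pb; near: tau.
Unshelve. all: by end_near. Qed.

End Separation.

(** * Cells, faces and neighbours of a periodic mesh *)

Section Cells.
Variable R : realType.

Lemma cell_lt n (M : mesh R n) (j : cell M) d : cell_lo j d < cell_hi j d.
Proof. exact: node_lt. Qed.

Lemma integral_on_cell n (M : mesh R n) (j : cell M) :
  integral_on [set x | in_cell j x] (cell_int j).
Proof.
split=> [g h gh|K c phi cphi]; first exact: eq_box_int.
rewrite /cell_int box_int_sum => [|k _].
  by apply: eq_bigr => k _; rewrite box_intZ.
by apply: continuous_mul => //; exact: continuous_cst.
Qed.

Lemma continuous_cell_int (U : topologicalType) n (M : mesh R n) (j : cell M)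
    (g : U -> 'rV[R]_n -> R) :
  continuous (fun p : U * 'rV[R]_n => g p.1 p.2) ->
  continuous (fun u => cell_int j (g u)).
Proof. exact: continuous_box_int. Qed.

Lemma integral_on_phase (MO MV : mesh R 3) (j : cell MO) (k : cell MV) :
  integral_on [set p : 'rV[R]_3 * 'rV[R]_3 | in_cell j p.1 /\ in_cell k p.2]
    (fun g => phase_int j k (fun x v => g (x, v))).
Proof.
have [jE jL] := integral_on_cell j; have [kE kL] := integral_on_cell k.
split=> [g h gh|K c phi cphi].
  by apply: jE => x xj; apply: kE => v vk; apply: gh.
rewrite /phase_int -jL => [|i].
  apply: jE => x _; rewrite -kL // => i.
  apply: continuous_compose (cphi i) _; apply: continuous_pairing.
    exact: continuous_cst.
  by move=> ?; exact: cvg_id.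
apply: (continuous_cell_int (g := fun x v => phi i (x, v))).
by under eq_fun do rewrite -surjective_pairing; exact: cphi.
Qed.

Lemma cell_intD n (M : mesh R n) (j : cell M) (g h : 'rV[R]_n -> R) :
  continuous g -> continuous h ->
  cell_int j (fun x => g x + h x) = cell_int j g + cell_int j h.
Proof. exact: box_intD. Qed.

Lemma cell_intZ n (M : mesh R n) (j : cell M) c (g : 'rV[R]_n -> R) :
  continuous g -> cell_int j (fun x => c * g x) = c * cell_int j g.
Proof. exact: box_intZ. Qed.

Lemma cell_int_sum n (M : mesh R n) (j : cell M) (I : finType)
    (F : I -> 'rV[R]_n -> R) : (forall i, continuous (F i)) ->
  cell_int j (fun x => \sum_i F i x) = \sum_i cell_int j (F i).
Proof. by move=> cF; apply: box_int_sum. Qed.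

Lemma face_int_sum n (M : mesh R n.+1) (j : cell M) d up (I : finType)
    (F : I -> 'rV[R]_n.+1 -> R) : (forall i, continuous (F i)) ->
  face_int j d up (fun x => \sum_i F i x) = \sum_i face_int j d up (F i).
Proof.
move=> cF; rewrite /face_int box_int_sum // => i _; exact: continuous_slice.
Qed.

Lemma face_intD n (M : mesh R n.+1) (j : cell M) d up (g h : 'rV[R]_n.+1 -> R) :
  continuous g -> continuous h ->
  face_int j d up (fun x => g x + h x) = face_int j d up g + face_int j d up h.
Proof. by move=> cg ch; apply: box_intD; exact: continuous_slice. Qed.

Lemma neighbourK n (M : mesh R n) (j : cell M) d up :
  neighbour (neighbour j d up) d (~~ up) = j.
Proof.
apply/ffunP => i; rewrite !ffunE; case: eqP => // _.
by case: up => /=; rewrite ?ordSK ?ord_predK.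
Qed.

(** [across] overwrites coordinate [d]; going back restores [x] because that coordinate was the one
    of the face. *)
Lemma acrossK n (M : mesh R n) (j : cell M) d up (x : 'rV[R]_n) :
  x 0 d = face_coord j d up ->
  across (neighbour j d up) d (~~ up) (across j d up x) = x.
Proof.
move=> xd; apply/rowP => i; rewrite !mxE; case: eqP => // ->.
by rewrite neighbourK negbK xd.
Qed.

(** Neighbours in direction [d] have the same extent in all other directions, so the two faces are
    parametrised by the same box and [across] identifies their points. *)
Lemma face_int_neighbour n (M : mesh R n.+1) (j : cell M) d up
    (g g' : 'rV[R]_n.+1 -> R) :
  (forall x : 'rV[R]_n.+1, x 0 d = face_coord j d up -> g' (across j d up x) = - g x) ->
  face_int (neighbour j d up) d (~~ up) g' = - face_int j d up g.
Proof.
move=> gg'; rewrite /face_int -box_intN.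
have -> : (fun i => cell_lo (neighbour j d up) (lift d i)) = (fun i => cell_lo j (lift d i)).
  by apply/funext => i; rewrite /cell_lo ffunE eq_sym (negPf (neq_lift _ _)).
have -> : (fun i => cell_hi (neighbour j d up) (lift d i)) = (fun i => cell_hi j (lift d i)).
  by apply/funext => i; rewrite /cell_hi ffunE eq_sym (negPf (neq_lift _ _)).
apply: eq_box_int => y _; rewrite -gg' ?insertE //; congr g'.
apply/rowP => i; rewrite [RHS]mxE; case: (unliftP d i) => [k|] ->.
  by rewrite !insertE eq_sym (negPf (neq_lift _ _)).
by rewrite !insertE eqxx.
Qed.

(** Every face is counted once as an upper face and once as the lower face of the next cell, with
    opposite contributions; cyclic neighbours leave no face unpaired. *)
Lemma sum_boundary_int_eq0 n (M : mesh R n.+1)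
    (g : cell M -> 'I_n.+1 -> bool -> 'rV[R]_n.+1 -> R) :
  (forall j d (x : 'rV[R]_n.+1), x 0 d = face_coord j d true ->
     g (neighbour j d true) d false (across j d true x) = - g j d true x) ->
  \sum_j boundary_int j (g j) = 0.
Proof.
move=> gN; rewrite /boundary_int exchange_big big1 //= => d _.
under eq_bigr do rewrite big_bool.
(* Moving up by one cell permutes the cells, so lower faces can be indexed by the cell below
   them. *)
rewrite big_split /= [X in _ + X](reindex (fun j => neighbour j d true)) /=; last first.
  exists (fun j => neighbour j d false) => j _.
    exact: (neighbourK j d true).
  exact: (neighbourK j d false).
rewrite -big_split big1 //= => j _.
by rewrite (face_int_neighbour (up := true) (g := g j d true)) ?subrr // => x; exact: gN.
Qed.

Lemma sum_normal n (d : 'I_n) up (F : 'I_n -> R) :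
  \sum_i normal R d up 0 i * F i = (if up then 1 else - 1) * F d.
Proof.
rewrite (bigD1 d) //= big1 => [|i id]; last by rewrite !mxE (negPf id) andbF mulr0 mul0r.
by rewrite !mxE !eqxx mulr1 addr0.
Qed.

(** Gauss's theorem on a box: each direction is a fundamental theorem of calculus, and on a face
    normal to [d] only the component [d] of the field survives. *)
Lemma cell_divergence n (M : mesh R n.+1) (j : cell M) (F : 'I_n.+1 -> mvpoly R n.+1) :
  cell_int j (fun x => \sum_d peval (mderiv d (F d)) x) =
  boundary_int j (fun d up x => \sum_i normal R d up 0 i * peval (F i) x).
Proof.
rewrite cell_int_sum => [|d]; last exact: peval_continuous.
apply: eq_bigr => d _; rewrite big_bool /cell_int box_int_mderiv ?cell_lt //.
rewrite -box_intN; congr (_ + _); apply: eq_box_int => y _; rewrite sum_normal.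
  by rewrite mul1r.
by rewrite mulN1r.
Qed.

End Cells.

(** * Vector algebra and fluxes *)

Section Vectors3.
Variable R : realType.
Implicit Types u v nu e b : 'rV[R]_3.

Lemma sum_ord3 (F : 'I_3 -> R) : \sum_i F i = F 0 + F 1 + F 2%:R.
Proof.
rewrite !big_ord_recl big_ord0 addr0 addrA.
by congr (F _ + F _ + F _); apply: val_inj.
Qed.

Lemma add_ord3 :
  ((1 + 1 : 'I_3) = 2%:R) * ((1 + 2%:R : 'I_3) = 0) *
  ((2%:R + 1 : 'I_3) = 0) * ((2%:R + 2%:R : 'I_3) = 1).
Proof. by do !split; apply: val_inj. Qed.

Lemma cross_coord u v i :
  cross u v 0 i = u 0 (i + 1) * v 0 (i + 2%:R) - u 0 (i + 2%:R) * v 0 (i + 1).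
Proof. by rewrite mxE. Qed.

(** Behind the fact that the magnetic force does no work. *)
Lemma dot_cross_self u v : \sum_i u 0 i * cross u v 0 i = 0.
Proof. by rewrite sum_ord3 !cross_coord !add0r !add_ord3; ring. Qed.

(* The integrand left on a face of a cell after adding Faraday's law tested with
   B, Ampere's law tested with E and the divergence of E x B; primes denote the
   traces from the neighbour. *)
Definition face_power nu e b e' b' : R :=
  \sum_i cross nu (e 0 i *: (2^-1 *: (b' + b))) 0 i
  - \sum_i cross nu (b 0 i *: (2^-1 *: (e' + e))) 0 i
  + \sum_i nu 0 i * cross e b 0 i.

(** The products of traces from the same side cancel, and [face_power nu e b e' b'] reduces to
    $-\frac12\,\nu\cdot(e\times b'+e'\times b)$, which is symmetric in the two sides and odd in the
    normal. *)
Lemma face_powerN nu e b e' b' :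
  face_power (- nu) e' b' e b = - face_power nu e b e' b'.
Proof.
rewrite /face_power !sum_ord3 !cross_coord !mxE !add0r !add_ord3.
by field.
Qed.

(** This is $\nabla\cdot(E\times B)=B\cdot\nabla\times E-E\cdot\nabla\times B$: with component [i]
    of a field testing component [i] of an equation, the first sum is $-E\cdot\nabla\times B$ and
    the second is $-B\cdot\nabla\times E$. *)
Lemma curl_by_parts (E B : 'I_3 -> mvpoly R 3) (x : 'rV[R]_3) :
  \sum_i cross (pgrad (B i) x) (\row_k peval (E k) x) 0 i
  - \sum_i cross (pgrad (E i) x) (\row_k peval (B k) x) 0 i =
  \sum_d peval (mderiv d (E (d + 1) * B (d + 2%:R) - E (d + 2%:R) * B (d + 1))) x.
Proof.
rewrite !sum_ord3 !cross_coord !mxE !add0r !add_ord3 !mderivB !mderivM.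
by rewrite !pevalB !pevalD !pevalM; ring.
Qed.

(** Conservativity of the numerical flux: [lambda] is symmetric in the two sides and blind to the
    sign of the normal, while the jump and the normal component of the average change sign. *)
Lemma lax_friedrichsN n (nu am ap : 'rV[R]_n) fm fp :
  lax_friedrichs (- nu) ap am fp fm = - lax_friedrichs nu am ap fm fp.
Proof.
have dotN (w : 'rV[R]_n) : dot (- nu) w = - dot nu w.
  by rewrite /dot -sumrN; apply: eq_bigr => i _; rewrite mxE mulNr.
rewrite /lax_friedrichs !dotN !normrN maxC addrC [fm *: am + _]addrC; ring.
Qed.

Lemma normalN n (d : 'I_n) : normal R d false = - normal R d true.
Proof. by rewrite /normal scaleN1r scale1r. Qed.

End Vectors3.

(** * Continuity of traces and numerical fluxes *)

Section ContinuousVectors.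
Variables (R : realType) (U : topologicalType).

Lemma continuous_scale n (c : U -> R) (v : U -> 'rV[R]_n) :
  continuous c -> continuous v -> continuous (fun x => c x *: v x).
Proof.
move=> cc cv; apply: continuous_matrix => i j.
under eq_fun do rewrite mxE.
by apply: continuous_mul => //; exact: continuous_coord.
Qed.

Lemma continuous_vadd n (u v : U -> 'rV[R]_n) :
  continuous u -> continuous v -> continuous (fun x => u x + v x).
Proof.
move=> cu cv; apply: continuous_matrix => i j.
under eq_fun do rewrite mxE.
by apply: continuous_add; exact: continuous_coord.
Qed.

Lemma continuous_cross (u v : U -> 'rV[R]_3) :
  continuous u -> continuous v -> continuous (fun x => cross (u x) (v x)).
Proof.
move=> cu cv; apply: continuous_matrix => i j.
under eq_fun do rewrite mxE.
apply: continuous_add; last apply: continuous_opp.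
  by apply: continuous_mul; exact: continuous_coord.
by apply: continuous_mul; exact: continuous_coord.
Qed.

Lemma continuous_dot n (u v : U -> 'rV[R]_n) :
  continuous u -> continuous v -> continuous (fun x => dot (u x) (v x)).
Proof.
move=> cu cv; apply: continuous_sum => i _.
by apply: continuous_mul; exact: continuous_coord.
Qed.

Lemma continuous_row_mx m n (u : U -> 'rV[R]_m) (v : U -> 'rV[R]_n) :
  continuous u -> continuous v -> continuous (fun x => row_mx (u x) (v x)).
Proof.
move=> cu cv; apply: continuous_matrix => i j.
under eq_fun do rewrite mxE.
by case: (fintype.split j) => k; exact: continuous_coord.
Qed.

Lemma continuous_veval (M : mesh R 3) (F : config_vfield M) j (Z : U -> 'rV[R]_3) :
  continuous Z -> continuous (fun x => veval F j (Z x)).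
Proof.
move=> cZ; apply: continuous_matrix => i k.
under eq_fun do rewrite mxE.
exact: continuous_peval.
Qed.

Lemma continuous_pgrad n (p : mvpoly R n) (Z : U -> 'rV[R]_n) :
  continuous Z -> continuous (fun x => pgrad p (Z x)).
Proof.
move=> cZ; apply: continuous_matrix => i k.
under eq_fun do rewrite mxE.
exact: continuous_peval.
Qed.

Lemma continuous_across n (M : mesh R n) (j : cell M) d up (Z : U -> 'rV[R]_n) :
  continuous Z -> continuous (fun x => across j d up (Z x)).
Proof.
move=> cZ; apply: continuous_matrix => i k.
under eq_fun do rewrite mxE.
by case: eqP => _; [exact: continuous_cst|exact: continuous_coord].
Qed.

Lemma continuous_alpha (MO : mesh R 3) q m (E B : config_vfield MO) j
    (x v : U -> 'rV[R]_3) :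
  continuous x -> continuous v -> continuous (fun u => alpha q m E B j (x u) (v u)).
Proof.
move=> cx cv; apply: continuous_row_mx => //.
apply: continuous_scale; first exact: continuous_cst.
apply: continuous_vadd; first exact: continuous_veval.
by apply: continuous_cross => //; exact: continuous_veval.
Qed.

Lemma continuous_norm (f : U -> R) : continuous f -> continuous (fun x => `|f x|).
Proof. by move=> cf; apply: continuous_compose cf; exact: norm_continuous. Qed.

(** The penalty speed makes the flux non-polynomial, but maximum and absolute value preserve
    continuity, which is what additivity of the integrals asks for. *)
Lemma continuous_lax_friedrichs n (nu : 'rV[R]_n) (am ap : U -> 'rV[R]_n)
    (fm fp : U -> R) :
  continuous am -> continuous ap -> continuous fm -> continuous fp ->
  continuous (fun x => lax_friedrichs nu (am x) (ap x) (fm x) (fp x)).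
Proof.
move=> cam cap cfm cfp; rewrite /lax_friedrichs.
have cnu := @continuous_cst U 'rV[R]_n nu.
apply: continuous_add; last apply: continuous_opp.
  apply: continuous_mul; last exact: continuous_cst.
  by apply: continuous_dot => //; apply: continuous_vadd; exact: continuous_scale.
apply: continuous_mul; last by apply: continuous_add => //; exact: continuous_opp.
apply: continuous_mul; last exact: continuous_cst.
apply: (@max_fun_continuous _ U R).
  by apply: continuous_norm; exact: continuous_dot.
by apply: continuous_norm; exact: continuous_dot.
Qed.

End ContinuousVectors.

(** * Power of the field *)

Section Field.
Variables (R : realType) (MO MV : mesh R 3) (N : nat) (b : N.-tuple (mvpoly R (3 + 3))).
Implicit Types (F : config_vfield MO) (j : cell MO).

Lemma boundary_int_sum j (K : finType) (g : K -> 'I_3 -> bool -> 'rV[R]_3 -> R) :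
  (forall k d up, continuous (g k d up)) ->
  \sum_k boundary_int j (g k) = boundary_int j (fun d up x => \sum_k g k d up x).
Proof.
move=> cg; rewrite /boundary_int exchange_big; apply: eq_bigr => d _.
by rewrite exchange_big; apply: eq_bigr => up _; rewrite -face_int_sum.
Qed.

Lemma boundary_intBD j (g h k : 'I_3 -> bool -> 'rV[R]_3 -> R) :
  (forall d up, continuous (g d up)) -> (forall d up, continuous (h d up)) ->
  (forall d up, continuous (k d up)) ->
  boundary_int j g - boundary_int j h + boundary_int j k =
  boundary_int j (fun d up x => g d up x - h d up x + k d up x).
Proof.
move=> cg ch ck; rewrite /boundary_int -sumrB -big_split; apply: eq_bigr => d _ /=.
rewrite -sumrB -big_split; apply: eq_bigr => up _ /=.
have cN : continuous (fun x => - h d up x) by exact: continuous_opp.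
have -> : - face_int j d up (h d up) = face_int j d up (fun x => - h d up x).
  by rewrite /face_int box_intN.
by rewrite -!face_intD //; exact: continuous_add.
Qed.

Lemma cell_intB j (g h : 'rV[R]_3 -> R) : continuous g -> continuous h ->
  cell_int j g - cell_int j h = cell_int j (fun x => g x - h x).
Proof.
move=> cg ch; rewrite cell_intD //; last exact: continuous_opp.
by rewrite /cell_int box_intN.
Qed.

Lemma eq_boundary_int j (g h : 'I_3 -> bool -> 'rV[R]_3 -> R) :
  (forall d up x, g d up x = h d up x) -> boundary_int j g = boundary_int j h.
Proof.
move=> gh; apply: eq_bigr => d _; apply: eq_bigr => up _.
by apply: eq_box_int => y _.
Qed.

Lemma continuous_central F j (p : mvpoly R 3) d up i :
  continuous (fun x => cross (normal R d up) (peval p x *: central_flux F j d up x) 0 i).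
Proof.
have cid : continuous (fun x : 'rV[R]_3 => x) by move=> ?; exact: cvg_id.
apply: continuous_coord; apply: continuous_cross; first exact: continuous_cst.
apply: continuous_scale; first exact: peval_continuous.
apply: continuous_scale; first exact: continuous_cst.
apply: continuous_vadd; last exact: continuous_veval.
by apply: continuous_veval; exact: continuous_across.
Qed.

Lemma continuous_curl F j (p : mvpoly R 3) i :
  continuous (fun x => cross (pgrad p x) (veval F j x) 0 i).
Proof.
have cid : continuous (fun x : 'rV[R]_3 => x) by move=> ?; exact: cvg_id.
apply: continuous_coord; apply: continuous_cross; first exact: continuous_pgrad.
exact: continuous_veval.
Qed.

Lemma vcell_intE j (g : 'rV[R]_3 -> 'rV[R]_3) i :
  vcell_int j g 0 i = cell_int j (fun x => g x 0 i).
Proof. by rewrite mxE. Qed.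

Lemma vboundary_intE j (g : 'I_3 -> bool -> 'rV[R]_3 -> 'rV[R]_3) i :
  vboundary_int j g 0 i = boundary_int j (fun d up x => g d up x 0 i).
Proof. by rewrite mxE. Qed.

(** Reading off one component allows a different scalar test function for each, as needed to test
    the equation with the field itself. *)
Lemma faraday_component (E B : R -> config_vfield MO) t phi j i :
  faraday_eq MV b E B t -> in_Xh MV b phi ->
  cell_int j (fun x => peval (phi j) x * derive1 (fun tau => peval (B tau i j) x) t) =
  - boundary_int j (fun d up x =>
      cross (normal R d up) (peval (phi j) x *: central_flux (E t) j d up x) 0 i)
  + cell_int j (fun x => cross (pgrad (phi j) x) (veval (E t) j x) 0 i).
Proof.
move=> far Xphi.
have -> : cell_int j (fun x => peval (phi j) x * derive1 (fun tau => peval (B tau i j) x) t) =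
    cell_int j (fun x => (peval (phi j) x *: time_deriv B t j x) 0 i).
  by apply: eq_box_int => x _; rewrite !mxE.
have coord (u v w : 'rV[R]_3) u' v' w' : u + v - w = 0 ->
    u 0 i = u' -> v 0 i = v' -> w 0 i = w' -> u' = - v' + w'.
  by move=> /(congr1 (fun M : 'rV[R]_3 => M 0 i)); rewrite !mxE => + <- <- <-; clear; lra.
exact: coord (far phi Xphi j) (vcell_intE _ _ _) (vboundary_intE _ _ _) (vcell_intE _ _ _).
Qed.

Lemma ampere_component eps0 mu0 (E B J : R -> config_vfield MO) t phi j i :
  ampere_eq MV b eps0 mu0 E B J t -> in_Xh MV b phi ->
  eps0 * mu0 *
    cell_int j (fun x => peval (phi j) x * derive1 (fun tau => peval (E tau i j) x) t) =
  boundary_int j (fun d up x =>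
      cross (normal R d up) (peval (phi j) x *: central_flux (B t) j d up x) 0 i)
  - cell_int j (fun x => cross (pgrad (phi j) x) (veval (B t) j x) 0 i)
  - mu0 * cell_int j (fun x => peval (phi j) x * peval (J t i j) x).
Proof.
move=> amp Xphi.
have -> : cell_int j (fun x => peval (phi j) x * derive1 (fun tau => peval (E tau i j) x) t) =
    cell_int j (fun x => (peval (phi j) x *: time_deriv E t j x) 0 i).
  by apply: eq_box_int => x _; rewrite !mxE.
have -> : cell_int j (fun x => peval (phi j) x * peval (J t i j) x) =
    cell_int j (fun x => (peval (phi j) x *: veval (J t) j x) 0 i).
  by apply: eq_box_int => x _; rewrite !mxE.
have coord (a e : R) (u v w z : 'rV[R]_3) u' v' w' z' :
    a *: u - v + w = - e *: z -> u 0 i = u' -> v 0 i = v' -> w 0 i = w' -> z 0 i = z' ->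
    a * u' = v' - w' - e * z'.
  move=> /(congr1 (fun M : 'rV[R]_3 => M 0 i)); rewrite !mxE => + <- <- <- <-.
  by clear; lra.
exact: coord (amp phi Xphi j) (vcell_intE _ _ _) (vboundary_intE _ _ _)
  (vcell_intE _ _ _) (vcell_intE _ _ _).
Qed.

(** The left side is [mu0] times the rate of change of the field energy, the right side [- mu0]
    times the work on [J]. *)
Lemma field_power eps0 mu0 (E B J : R -> config_vfield MO) t :
  (forall i, in_Xh MV b (E t i)) -> (forall i, in_Xh MV b (B t i)) ->
  faraday_eq MV b E B t -> ampere_eq MV b eps0 mu0 E B J t ->
  eps0 * mu0 * (\sum_j \sum_i cell_int j (fun x =>
    peval (E t i j) x * derive1 (fun tau => peval (E tau i j) x) t))
  + \sum_j \sum_i cell_int j (fun x =>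
    peval (B t i j) x * derive1 (fun tau => peval (B tau i j) x) t) =
  - mu0 * \sum_j \sum_i cell_int j (fun x => peval (E t i j) x * peval (J t i j) x).
Proof.
move=> XE XB far amp.
pose H j d up x := face_power (normal R d up) (veval (E t) j x) (veval (B t) j x)
  (veval (E t) (neighbour j d up) (across j d up x))
  (veval (B t) (neighbour j d up) (across j d up x)).
(* Local energy balance: once the work on [J] is moved to the left, only boundary terms of the cell
   remain. *)
have balance j :
    eps0 * mu0 * (\sum_i cell_int j (fun x =>
      peval (E t i j) x * derive1 (fun tau => peval (E tau i j) x) t))
    + \sum_i cell_int j (fun x =>
      peval (B t i j) x * derive1 (fun tau => peval (B tau i j) x) t)
    + mu0 * \sum_i cell_int j (fun x => peval (E t i j) x * peval (J t i j) x) =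
    boundary_int j (H j).
  have sums a c (p q w ge gb ve vb : 'I_3 -> R) :
      (forall i, a * p i = ge i - ve i - c * w i) -> (forall i, q i = - gb i + vb i) ->
      a * (\sum_i p i) + \sum_i q i + c * (\sum_i w i) =
      \sum_i ge i - \sum_i gb i + (\sum_i vb i - \sum_i ve i).
    by move=> hp hq; rewrite !sum_ord3 !mulrDr !hp !hq; clear; lra.
  apply: (etrans (sums _ _ _ _ _ _ _ _ _
    (fun i => ampere_component j i amp (XE i)) (fun i => faraday_component j i far (XB i)))).
  have gsum F (phi : config_vfield MO) := boundary_int_sum j (fun i d up =>
    @continuous_central F j (phi i j) d up i).
  have vsum F (phi : config_vfield MO) := @cell_int_sum _ _ _ j _ _ (fun i =>
    @continuous_curl F j (phi i j) i).
  apply: (etrans (congr2 +%R (congr2 (fun u v => u - v) (gsum (B t) (E t)) (gsum (E t) (B t)))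
    (congr2 (fun u v => u - v) (esym (vsum (E t) (B t))) (esym (vsum (B t) (E t)))))).
  have csum F (phi : config_vfield MO) : continuous (fun x =>
      \sum_i cross (pgrad (phi i j) x) (veval F j x) 0 i).
    by apply: continuous_sum => i _; exact: continuous_curl.
  (* The volume terms form the divergence of $E\times B$ and become its outward flux, computed with
     the inner traces. *)
  have volume :
      cell_int j (fun x => \sum_i cross (pgrad (B t i j) x) (veval (E t) j x) 0 i)
      - cell_int j (fun x => \sum_i cross (pgrad (E t i j) x) (veval (B t) j x) 0 i) =
      boundary_int j (fun d up x => \sum_i normal R d up 0 i *
        cross (veval (E t) j x) (veval (B t) j x) 0 i).
    apply: (etrans (cell_intB j (csum (E t) (B t)) (csum (B t) (E t)))).
    pose F d := E t (d + 1) j * B t (d + 2%:R) j - E t (d + 2%:R) j * B t (d + 1) j.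
    transitivity (cell_int j (fun x => \sum_d peval (mderiv d (F d)) x)).
      apply: eq_box_int => x _.
      exact: (curl_by_parts (fun i => E t i j) (fun i => B t i j)).
    apply: (etrans (cell_divergence j F)).
    apply: eq_boundary_int => d up x; apply: eq_bigr => i _; congr (_ * _).
    by rewrite cross_coord !mxE pevalB !pevalM.
  apply: (etrans (congr1 _ volume)).
  have cid : continuous (fun x : 'rV[R]_3 => x) by move=> ?; exact: cvg_id.
  rewrite boundary_intBD; last 3 first.
  - by move=> d up; apply: continuous_sum => i _; exact: continuous_central.
  - by move=> d up; apply: continuous_sum => i _; exact: continuous_central.
  - move=> d up; apply: continuous_sum => i _; apply: continuous_mul.
      exact: continuous_cst.
    by apply: continuous_coord; apply: continuous_cross; exact: continuous_veval.
  apply: eq_boundary_int => d up x; rewrite /H /face_power.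
  congr (_ - _ + _); apply: eq_bigr => i _; congr ((cross _ _ : 'rV[R]_3) 0 i);
    congr (_ *: _); by rewrite mxE.
(* Seen from the neighbour, the normal is reversed and the two traces are exchanged, so
   [face_powerN] cancels the faces in pairs. *)
have total : \sum_j boundary_int j (H j) = 0.
  apply: sum_boundary_int_eq0 => j d x xd; rewrite /H normalN.
  by rewrite (neighbourK j d true) (acrossK xd) face_powerN.
have sums a c (p q w h : cell MO -> R) : (forall j, a * p j + q j + c * w j = h j) ->
    \sum_j h j = 0 -> a * (\sum_j p j) + \sum_j q j = - c * \sum_j w j.
  move=> /(fun e => eq_bigr _ (fun j (_ : true) => e j)) <-.
  by rewrite !big_split /= -!mulr_sumr mulNr => /eqP; rewrite addr_eq0 => /eqP.
exact: (sums _ _ _ _ _ _ balance total).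
Qed.
End Field.

(** * Power of the particles *)

Section Particles.
Variables (R : realType) (MO MV : mesh R 3) (N : nat) (b : N.-tuple (mvpoly R (3 + 3))).

Lemma speed_sqE (x v : 'rV[R]_3) : peval (speed_sq R) (row_mx x v) = dot v v.
Proof.
rewrite /speed_sq peval_sum; apply: eq_bigr => i _.
by rewrite expr2 pevalM /peval mevalXU row_mxEr.
Qed.

Lemma peval_mderiv_var n (r i : 'I_n) (z : 'rV[R]_n) :
  peval (mderiv i (mpolyX R (mnm1 r))) z = (r == i)%:R.
Proof.
rewrite mderivX pevalZ mnm1E; case: eqP => [->|_]; last by rewrite mul0r.
by rewrite mul1r /peval mevalX big1 // => k _; rewrite mnmBE subnn.
Qed.

Lemma pgrad_speed_sq (x v : 'rV[R]_3) :
  pgrad (speed_sq R) (row_mx x v) = row_mx 0 (2 *: v).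
Proof.
have sq i r : peval (mderiv i (mpolyX R (mnm1 (rshift 3 r)) ^+ 2)) (row_mx x v) =
    2 * (rshift 3 r == i)%:R * v 0 r.
  rewrite expr2 mderivM pevalD !pevalM !peval_mderiv_var /peval !mevalXU !row_mxEr; ring.
apply/rowP => i; rewrite [LHS]mxE /speed_sq raddf_sum /= peval_sum.
under eq_bigr do rewrite sq.
case: (fintype.splitP i) => k ik.
  have -> : i = lshift 3 k by apply: val_inj.
  rewrite row_mxEl mxE big1 // => r _.
  by rewrite eq_rlshift mulr0 mul0r.
have -> : i = rshift 3 k by apply: val_inj.
rewrite row_mxEr mxE (bigD1 k) //= big1 => [|r rk].
  by rewrite eqxx mulr1 addr0.
by rewrite eq_rshift (negPf rk) mulr0 mul0r.
Qed.

(** The gradient of $|v|^2$ has no configuration component, so only the acceleration enters, and its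
    magnetic part is orthogonal to [v]. *)
Lemma work_density q m (E B : config_vfield MO) j (x v : 'rV[R]_3) :
  dot (pgrad (speed_sq R) (row_mx x v)) (alpha q m E B j x v) =
  2 * (q / m) * \sum_i peval (E i j) x * v 0 i.
Proof.
rewrite pgrad_speed_sq /alpha /dot big_split_ord /= big1 ?add0r => [|i _]; last first.
  by rewrite row_mxEl mxE mul0r.
have := dot_cross_self v (veval B j x); rewrite !sum_ord3 !row_mxEr => ortho.
have coord i : ((q / m) *: (veval E j x + cross v (veval B j x))) 0 i =
    q / m * (peval (E i j) x + cross v (veval B j x) 0 i) by rewrite !mxE.
rewrite !coord ![(2 *: v) 0 _]mxE.
move: ortho; move: (cross _ _ 0 _) (cross _ _ 0 _) (cross _ _ 0 _) => c2 c1 c0 ortho.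
transitivity (2 * (q / m) * ((peval (E 0 j) x * v 0 0 + peval (E 1 j) x * v 0 1
  + peval (E 2%:R j) x * v 0 2%:R) + (v 0 0 * c0 + v 0 1 * c1 + v 0 2%:R * c2))).
  by clear; ring.
by rewrite ortho addr0.
Qed.

Lemma flux_config_neighbour q m (E B : config_vfield MO) (f : phase_fun MO MV) j k d
    (x v : 'rV[R]_3) : x 0 d = face_coord j d true ->
  flux_config q m E B f (neighbour j d true) k d false (across j d true x) v =
  - flux_config q m E B f j k d true x v.
Proof.
move=> xd; rewrite /flux_config (neighbourK j d true) (acrossK xd) normalN.
have -> : row_mx (- normal R d true) (0 : 'rV[R]_3) = - row_mx (normal R d true) 0.
  by rewrite opp_row_mx oppr0.
exact: lax_friedrichsN.
Qed.

(** The cyclic successor of the last cell is the first one, so the zero-flux condition applies to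
    both faces of a pair or to neither. *)
Lemma on_boundary_neighbour n (M : mesh R n) (k : cell M) d :
  on_boundary (neighbour k d true) d false = on_boundary k d true.
Proof.
rewrite /on_boundary ffunE eqxx /=; have := ltn_ord (k d).
rewrite leq_eqVlt => /orP[/eqP -> |lt]; first by rewrite modnn !eqxx.
by rewrite modn_small // (ltn_eqF lt).
Qed.

(** Without wrap-around the two cells share the node of the face. This keeps $|v|^2$, which is not
    periodic in [v], single-valued on interior faces. *)
Lemma across_interior n (M : mesh R n) (k : cell M) d (v : 'rV[R]_n) :
  ~~ on_boundary k d true -> v 0 d = face_coord k d true -> across k d true v = v.
Proof.
rewrite /on_boundary => kd vd; apply/rowP => i; rewrite mxE; case: eqP => // ->.
rewrite vd /face_coord /cell_lo /cell_hi ffunE eqxx /= modn_small //.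
by rewrite ltn_neqAle kd ltn_ord.
Qed.

Lemma flux_velocity_neighbour q m (E B : config_vfield MO) (f : phase_fun MO MV) j k d
    (x v : 'rV[R]_3) : v 0 d = face_coord k d true ->
  flux_velocity q m E B f j (neighbour k d true) d false x (across k d true v) =
  - flux_velocity q m E B f j k d true x v.
Proof.
move=> vd; rewrite /flux_velocity on_boundary_neighbour.
case: ifP => _; first by rewrite oppr0.
rewrite (neighbourK k d true) (acrossK vd) normalN.
have -> : row_mx (0 : 'rV[R]_3) (- normal R d true) = - row_mx 0 (normal R d true).
  by rewrite opp_row_mx oppr0.
exact: lax_friedrichsN.
Qed.

(** The weight is independent of [x], hence the same on both sides of a face, including the
    periodically identified ones. *)
Lemma sum_config_flux_eq0 q m (E B : config_vfield MO) (f : phase_fun MO MV) k :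
  \sum_j boundary_int j (fun d up x => cell_int k (fun v =>
    peval (speed_sq R) (row_mx x v) * flux_config q m E B f j k d up x v)) = 0.
Proof.
apply: (sum_boundary_int_eq0 (g := fun j d up x => cell_int k (fun v =>
    peval (speed_sq R) (row_mx x v) * flux_config q m E B f j k d up x v))).
move=> j d x xd; rewrite /cell_int -box_intN; apply: eq_box_int => v _.
by rewrite flux_config_neighbour // !speed_sqE mulrN.
Qed.

(** On interior faces the weight is single-valued and the fluxes are opposite. The cyclic pairing of
    opposite ends of [V] is fictitious and the weights may differ there, but the flux is zero. The
    identity is pointwise in [x], to be integrated over the configuration cell afterwards. *)
Lemma sum_velocity_flux_eq0 q m (E B : config_vfield MO) (f : phase_fun MO MV) j x :
  \sum_k boundary_int k (fun d up v =>
    peval (speed_sq R) (row_mx x v) * flux_velocity q m E B f j k d up x v) = 0.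
Proof.
apply: (sum_boundary_int_eq0 (g := fun k d up v =>
    peval (speed_sq R) (row_mx x v) * flux_velocity q m E B f j k d up x v)).
move=> k d v vd; rewrite flux_velocity_neighbour // mulrN.
have [bd|bd] := boolP (on_boundary k d true); last by rewrite across_interior.
by rewrite /flux_velocity bd !mulr0.
Qed.

(** Allows the sum over velocity cells to enter the integral over the configuration cell. *)
Lemma continuous_velocity_flux q m (E B : config_vfield MO) (f : phase_fun MO MV) j k :
  continuous (fun x => boundary_int k (fun d up v =>
    peval (speed_sq R) (row_mx x v) * flux_velocity q m E B f j k d up x v)).
Proof.
apply: continuous_sum => d _; apply: continuous_sum => up _.
apply: (continuous_box_int (g := fun x y => peval (speed_sq R)
   (row_mx x (insert d (face_coord k d up) y)) *
   flux_velocity q m E B f j k d up x (insert d (face_coord k d up) y))).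
pose P := ('rV[R]_3 * 'rV[R]_2)%type.
have cx := @continuous_fst 'rV[R]_3 'rV[R]_2.
have cv : continuous (fun p : P => insert d (face_coord k d up) p.2).
  by apply: continuous_insert; [exact: continuous_cst|exact: continuous_snd].
have cv' : continuous (fun p : P => across k d up (insert d (face_coord k d up) p.2)).
  exact: continuous_across.
have cz := continuous_row_mx cx cv; have cz' := continuous_row_mx cx cv'.
have cf w := @continuous_peval _ _ _ w _ cz; have cf' w := @continuous_peval _ _ _ w _ cz'.
have ca F := @continuous_alpha _ P MO q m E B j _ _ cx F.
apply: (continuous_mul (cf (speed_sq R))).
rewrite /flux_velocity; case: (on_boundary k d up); first exact: continuous_cst.
exact: (continuous_lax_friedrichs (ca _ cv) (ca _ cv') (cf _) (cf' _)).
Qed.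

(** The electric field depends on [x] alone and leaves the velocity integral, so that only the first
    velocity moment of [p] remains. *)
Lemma work_phase_int q m (E B : config_vfield MO) (p : mvpoly R (3 + 3)) j (k : cell MV) :
  phase_int j k (fun x v =>
    dot (pgrad (speed_sq R) (row_mx x v)) (alpha q m E B j x v) * peval p (row_mx x v)) =
  2 * (q / m) * cell_int j (fun x => \sum_i peval (E i j) x *
    cell_int k (fun v => peval p (row_mx x v) * v 0 i)).
Proof.
have cpv i : continuous (fun u : 'rV[R]_3 * 'rV[R]_3 => peval p (row_mx u.1 u.2) * u.2 0 i).
  apply: continuous_mul.
    apply: continuous_peval; apply: continuous_row_mx.
      exact: continuous_fst.
    exact: continuous_snd.
  by apply: continuous_coord; exact: continuous_snd.
have cW : continuous (fun x => \sum_i peval (E i j) x *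
    cell_int k (fun v => peval p (row_mx x v) * v 0 i)).
  apply: continuous_sum => i _; apply: continuous_mul; first exact: peval_continuous.
  exact: (continuous_cell_int (g := fun x v => peval p (row_mx x v) * v 0 i)).
apply: (etrans _ (cell_intZ j (2 * (q / m)) cW)).
apply: eq_box_int => x _.
have [kE kL] := integral_on_cell k.
have cv i : continuous (fun v : 'rV[R]_3 => peval p (row_mx x v) * v 0 i).
  apply: (continuous_compose (cpv i) (f := fun v => (x, v))).
  by apply: continuous_pairing; [exact: continuous_cst | move=> ?; exact: cvg_id].
rewrite mulr_sumr.
transitivity (cell_int k (fun v => \sum_i (2 * (q / m) * peval (E i j) x) *
    (peval p (row_mx x v) * v 0 i))).
  apply: eq_box_int => v _; rewrite work_density -mulrA mulr_suml mulr_sumr.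
  by apply: eq_bigr => i _; ring.
rewrite (kL _ (fun i => 2 * (q / m) * peval (E i j) x) _ cv).
by apply: eq_bigr => i _; rewrite -mulrA.
Qed.

(** The factor [m / 2] turns $|v|^2$ into kinetic energy and cancels against the [2 * (q / m)] of
    the work density, leaving the charge. *)
Lemma kinetic_power q m (E B : R -> config_vfield MO) (f : R -> phase_fun MO MV) t :
  m != 0 -> in_Vh b (fun (_ : cell MO) (_ : cell MV) => speed_sq R) ->
  vlasov_eq b q m E B f t ->
  m / 2 * (\sum_j \sum_k phase_int j k (fun x v => peval (speed_sq R) (row_mx x v) *
    derive1 (fun tau => peval (f tau j k) (row_mx x v)) t)) =
  q * \sum_j \sum_k cell_int j (fun x => \sum_i peval (E t i j) x *
    cell_int k (fun v => peval (f t j k) (row_mx x v) * v 0 i)).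
Proof.
move=> m0 Vspeed vlasov.
have sums (p c v w : cell MO -> cell MV -> R) :
    (forall j k, p j k + (c j k + v j k) - 2 * (q / m) * w j k = 0) ->
    (forall k, \sum_j c j k = 0) -> (forall j, \sum_k v j k = 0) ->
    m / 2 * (\sum_j \sum_k p j k) = q * \sum_j \sum_k w j k.
  move=> pcvw c0 v0.
  (* The flux sums are taken in opposite orders: configuration faces are paired at fixed [k],
     velocity faces at fixed [j]. *)
  have -> : \sum_j \sum_k p j k = 2 * (q / m) * \sum_j \sum_k w j k
      - \sum_k \sum_j c j k - \sum_j \sum_k v j k.
    rewrite [X in _ - X - _]exchange_big mulr_sumr -!sumrB; apply: eq_bigr => j _.
    rewrite mulr_sumr -!sumrB; apply: eq_bigr => k _; have := pcvw j k; clear; lra.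
  have -> : \sum_k \sum_j c j k = 0 by rewrite big1.
  have -> : \sum_j \sum_k v j k = 0 by rewrite big1.
  rewrite !subr0 mulrA; congr (_ * _); by field.
(* The test function is $|v|^2$, admissible by assumption. *)
have weak j k := vlasov _ Vspeed j k.
have weak' j k := etrans (esym (congr1 (fun w => _ - w)
  (work_phase_int q m (E t) (B t) (f t j k) j k))) (weak j k).
apply: (sums _ _ _ _ weak') => [k|j]; first exact: sum_config_flux_eq0.
rewrite -cell_int_sum => [|k]; last exact: continuous_velocity_flux.
transitivity (cell_int j (fun=> 0 : R)); last exact: box_int0.
by apply: eq_box_int => x _; exact: sum_velocity_flux_eq0.
Qed.

End Particles.

(** * Energy rates *)

Lemma is_derive_val (R : realType) (h : R -> R) (t dh : R) :
  is_derive t (1 : R) h dh -> 'D_1 h t = dh.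
Proof. by case. Qed.

Section EnergyRates.
Variables (R : realType) (A : topologicalType) (X : set A) (I : (A -> R) -> R).
Hypothesis intI : integral_on X I.

Lemma integral_onZ c (g : A -> R) : continuous g -> I (fun y => c * g y) = c * I g.
Proof.
case: intI => [IE IL] cg.
have := IL 'I_1 (fun=> c) (fun=> g) (fun=> cg); rewrite big_ord1 => <-.
by apply: IE => y _; rewrite big_ord1.
Qed.

(** The pointwise time derivative stays under the integral, in the form in which it occurs in the
    weak equations. *)
Lemma is_derive_weighted t (F : R -> A -> R) c (g : A -> R) :
  continuous g -> separated X t F ->
  is_derive t (1 : R) (fun tau => I (fun y => c * g y * F tau y))
    (c * I (fun y => g y * derive1 (fun tau => F tau y) t)).
Proof.
move=> cg sF; have [D [cD dF _]] := separated_derive sF.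
have ccg : continuous (fun y => c * g y).
  by apply: continuous_mul => //; exact: continuous_cst.
have [D' [_ dF' dI]] := separated_derive (separatedM (separated_cst X t ccg) sF).
suff <- : I D' = c * I (fun y => g y * derive1 (fun tau => F tau y) t) by exact: dI.
case: (intI) => IE _.
have -> : I (fun y => g y * derive1 (fun tau => F tau y) t) = I (fun y => g y * D y).
  by apply: IE => y Xy; rewrite derive1E (is_derive_val (dF y Xy)).
rewrite -integral_onZ; last exact: continuous_mul.
apply: IE => y Xy; rewrite -(is_derive_val (dF' y Xy)).
have h := is_deriveZ (c * g y) (dF y Xy).
by rewrite (is_derive_val h) mulrA.
Qed.

Lemma is_derive_square t (F : R -> A -> R) :
  continuous (F t) -> separated X t F ->
  is_derive t (1 : R) (fun tau => I (fun y => F tau y * F tau y))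
    (2 * I (fun y => F t y * derive1 (fun tau => F tau y) t)).
Proof.
move=> cF sF; have [D [cD dF _]] := separated_derive sF.
have [D' [_ dF' dI]] := separated_derive (separatedM sF sF).
suff <- : I D' = 2 * I (fun y => F t y * derive1 (fun tau => F tau y) t) by exact: dI.
case: (intI) => IE _.
have -> : I (fun y => F t y * derive1 (fun tau => F tau y) t) = I (fun y => F t y * D y).
  by apply: IE => y Xy; rewrite derive1E (is_derive_val (dF y Xy)).
rewrite -integral_onZ; last exact: continuous_mul.
apply: IE => y Xy; rewrite -(is_derive_val (dF' y Xy)).
have h := is_deriveM (dF y Xy) (dF y Xy).
by rewrite (is_derive_val h) -mulr2n mulr_natl.
Qed.

Lemma is_derive_bigsum (K : finType) t (h : K -> R -> R) (dh : K -> R) :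
  (forall k, is_derive t (1 : R) (h k) (dh k)) ->
  is_derive t (1 : R) (fun tau => \sum_k h k tau) (\sum_k dh k).
Proof.
move=> d; have -> : (fun tau => \sum_k h k tau) = \sum_k h k.
  by apply/funext => tau; rewrite fct_sumE.
by elim/big_ind2 : _ => [|f df g dg hf hg|k _]; [exact: is_derive_cst|exact: is_deriveD|].
Qed.

End EnergyRates.

(** * Differentiated energies and the work of the current *)

Section Conservation.
Variables (R : realType) (MO MV : mesh R 3) (N : nat) (b : N.-tuple (mvpoly R (3 + 3))).

Lemma peval_lift_config (p : mvpoly R 3) (x v : 'rV[R]_3) :
  peval (lift_config p) (row_mx x v) = peval p x.
Proof.
rewrite /peval /lift_config comp_mpoly_meval; apply: meval_eq => i.
by rewrite tnth_mktuple mevalXU row_mxEl.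
Qed.

(** Membership in [in_Xh] concerns the lift to phase space. The lift does not depend on [v], so it
    may be evaluated at [v = 0] even if this point lies outside [V]. *)
Lemma separated_config (T : set R) t (F : R -> config_vfield MO) i j :
  open T -> T t -> (forall tau, T tau -> in_Xh MV b (F tau i)) ->
  (forall x, in_cell j x -> derivable (fun tau => peval (F tau i j) x) t 1) ->
  separated [set x | in_cell j x] t (fun tau x => peval (F tau i j) x).
Proof.
move=> oT Tt FX dF.
(* Any velocity cell gives the span condition; the one of index 0 exists since every direction has a
   cell. *)
pose k0 : cell MV := [ffun d => Ordinal (ncells_gt0 MV d)].
have E tau x : peval (F tau i j) x = peval (lift_config (F tau i j)) (row_mx x 0).
  by rewrite peval_lift_config.
under [X in separated _ _ X]eq_fun do under eq_fun do rewrite E.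
apply: (separated_peval (T := T) (b := b) (p := fun tau => lift_config (F tau i j))) => //.
- apply: continuous_row_mx; last exact: continuous_cst.
  by move=> ?; exact: cvg_id.
- by move=> tau Ttau; exact: FX tau Ttau j k0.
- by move=> x xj; under eq_fun do rewrite -E; exact: dF.
Qed.

Lemma separated_phase (T : set R) t (f : R -> phase_fun MO MV) j k :
  open T -> T t -> (forall tau, T tau -> in_Vh b (f tau)) ->
  (forall x v, in_cell j x -> in_cell k v ->
    derivable (fun tau => peval (f tau j k) (row_mx x v)) t 1) ->
  separated [set p : 'rV[R]_3 * 'rV[R]_3 | in_cell j p.1 /\ in_cell k p.2] t
    (fun tau p => peval (f tau j k) (row_mx p.1 p.2)).
Proof.
move=> oT Tt fV df.
apply: (separated_peval (T := T) (b := b) (p := fun tau => f tau j k)) => //.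
- by apply: continuous_row_mx; [exact: continuous_fst | exact: continuous_snd].
- by move=> tau Ttau; exact: fV.
- by move=> [x v] [] /=; exact: df.
Qed.

Lemma is_derive_particle_energy (S : finType) (m : S -> R) (T : set R) t
    (f : S -> R -> phase_fun MO MV) :
  open T -> T t -> (forall s tau, T tau -> in_Vh b (f s tau)) ->
  (forall s j k x v, in_cell j x -> in_cell k v ->
    derivable (fun tau => peval (f s tau j k) (row_mx x v)) t 1) ->
  is_derive t (1 : R) (fun tau => particle_energy m (fun s => f s tau))
    (\sum_s m s / 2 * \sum_j \sum_k phase_int j k (fun x v =>
       peval (speed_sq R) (row_mx x v) *
       derive1 (fun tau => peval (f s tau j k) (row_mx x v)) t)).
Proof.
move=> oT Tt fV df.
pose P s j k := phase_int j k (fun x v => peval (speed_sq R) (row_mx x v) *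
       derive1 (fun tau => peval (f s tau j k) (row_mx x v)) t).
have -> : \sum_s m s / 2 * \sum_j \sum_k P s j k = \sum_j \sum_k \sum_s m s / 2 * P s j k.
  under eq_bigr do rewrite mulr_sumr.
  rewrite exchange_big; apply: eq_bigr => j _.
  under eq_bigr do rewrite mulr_sumr.
  by rewrite exchange_big.
apply: is_derive_bigsum => j; apply: is_derive_bigsum => k; apply: is_derive_bigsum => s.
have cz : continuous (fun p : 'rV[R]_3 * 'rV[R]_3 => row_mx p.1 p.2).
  by apply: continuous_row_mx; [exact: continuous_fst | exact: continuous_snd].
have h := is_derive_weighted (integral_on_phase j k) (m s / 2)
  (@continuous_peval _ _ _ (speed_sq R) _ cz) (separated_phase oT Tt (fV s) (@df s j k)).
apply: near_eq_is_derive h; near=> tau.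
apply: eq_box_int => x _; apply: eq_box_int => v _.
by rewrite /= speed_sqE [2^-1 * _]mulrC.
Unshelve. all: by end_near. Qed.

Lemma field_energyE eps0 mu0 (E B : config_vfield MO) :
  field_energy eps0 mu0 E B =
  eps0 / 2 * (\sum_j \sum_i cell_int j (fun x => peval (E i j) x * peval (E i j) x))
  + 1 / (2 * mu0) * (\sum_j \sum_i cell_int j (fun x => peval (B i j) x * peval (B i j) x)).
Proof.
have csq (F : config_vfield MO) j i : continuous (fun x => peval (F i j) x * peval (F i j) x).
  by apply: continuous_mul; exact: peval_continuous.
have cS (F : config_vfield MO) j : continuous (fun x => \sum_i peval (F i j) x * peval (F i j) x).
  by apply: continuous_sum => i _; exact: csq.
have cZ c (F : config_vfield MO) j :
    continuous (fun x => c * \sum_i peval (F i j) x * peval (F i j) x).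
  by apply: continuous_mul; [exact: continuous_cst | exact: cS].
have sums (a c : R) (e p q : cell MO -> R) :
    (forall j, e j = a * p j + c * q j) ->
    \sum_j e j = a * (\sum_j p j) + c * (\sum_j q j).
  by move=> epq; rewrite !mulr_sumr -big_split; apply: eq_bigr => j _.
apply: sums => j.
apply: (etrans _ (congr2 (fun u v => eps0 / 2 * u + 1 / (2 * mu0) * v)
  (cell_int_sum j (csq E j)) (cell_int_sum j (csq B j)))).
apply: (etrans _ (congr2 +%R (cell_intZ j _ (cS E j)) (cell_intZ j _ (cS B j)))).
apply: (etrans _ (cell_intD j (cZ _ E j) (cZ _ B j))).
have dotE (F : config_vfield MO) x :
    dot (veval F j x) (veval F j x) = \sum_i peval (F i j) x * peval (F i j) x.
  by apply: eq_bigr => i _; rewrite mxE.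
by apply: eq_box_int => x _; rewrite !dotE.
Qed.

Lemma is_derive_field_energy eps0 mu0 (T : set R) t (E B : R -> config_vfield MO) :
  open T -> T t ->
  (forall tau, T tau -> forall i, in_Xh MV b (E tau i)) ->
  (forall tau, T tau -> forall i, in_Xh MV b (B tau i)) ->
  (forall i j x, in_cell j x -> derivable (fun tau => peval (E tau i j) x) t 1) ->
  (forall i j x, in_cell j x -> derivable (fun tau => peval (B tau i j) x) t 1) ->
  is_derive t (1 : R) (fun tau => field_energy eps0 mu0 (E tau) (B tau))
    (eps0 * (\sum_j \sum_i cell_int j (fun x =>
       peval (E t i j) x * derive1 (fun tau => peval (E tau i j) x) t))
     + mu0^-1 * \sum_j \sum_i cell_int j (fun x =>
       peval (B t i j) x * derive1 (fun tau => peval (B tau i j) x) t)).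
Proof.
move=> oT Tt EX BX dE dB.
under [X in is_derive _ _ X]eq_fun do rewrite field_energyE.
have energy (F : R -> config_vfield MO) :
    (forall tau, T tau -> forall i, in_Xh MV b (F tau i)) ->
    (forall i j x, in_cell j x -> derivable (fun tau => peval (F tau i j) x) t 1) ->
    is_derive t (1 : R) (fun tau => \sum_j \sum_i cell_int j (fun x =>
        peval (F tau i j) x * peval (F tau i j) x))
      (2 * \sum_j \sum_i cell_int j (fun x =>
       peval (F t i j) x * derive1 (fun tau => peval (F tau i j) x) t)).
  move=> FX dF; rewrite mulr_sumr; apply: is_derive_bigsum => j.
  rewrite mulr_sumr; apply: is_derive_bigsum => i.
  apply: (is_derive_square (integral_on_cell j) (F := fun tau x => peval (F tau i j) x)).
    exact: peval_continuous.
  by apply: (separated_config oT Tt) => [tau Ttau|]; [exact: FX|exact: dF].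
have dEB := is_deriveD (is_deriveZ (eps0 / 2) (energy E EX dE))
  (is_deriveZ (1 / (2 * mu0)) (energy B BX dB)).
apply: is_derive_eq dEB _.
have halves (u v : R) : (eps0 / 2) * (2 * u) + (1 / (2 * mu0)) * (2 * v) = eps0 * u + mu0^-1 * v.
  by rewrite invfM; move: (mu0^-1) => w; field.
exact: halves.
Qed.

(** Each component of [E] lies in the space projected onto, so [J] may be replaced by the exact
    current when tested against it. *)
Lemma current_power (S : finType) (q : S -> R) (f : S -> phase_fun MO MV)
    (E J : config_vfield MO) :
  (forall i, in_Xh MV b (E i)) -> is_L2_projection MV b (current q f) J ->
  \sum_j \sum_i cell_int j (fun x => peval (E i j) x * peval (J i j) x) =
  \sum_s q s * \sum_j \sum_k cell_int j (fun x => \sum_i peval (E i j) x *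
    cell_int k (fun v => peval (f s j k) (row_mx x v) * v 0 i)).
Proof.
move=> EX [_ proj].
pose M s j k i x := cell_int k (fun v => peval (f s j k) (row_mx x v) * v 0 i).
have cM s j k i : continuous (fun x => peval (E i j) x * M s j k i x).
  apply: continuous_mul; first exact: peval_continuous.
  apply: (continuous_cell_int (g := fun x v => peval (f s j k) (row_mx x v) * v 0 i)).
  have cz := continuous_row_mx (@continuous_fst 'rV[R]_3 'rV[R]_3)
    (@continuous_snd 'rV[R]_3 'rV[R]_3).
  apply: continuous_mul; first exact: continuous_peval.
  by apply: continuous_coord; exact: continuous_snd.
have currentE j x i : current q f j x 0 i = \sum_s q s * \sum_k M s j k i x.
  rewrite /current summxE; apply: eq_bigr => s _; rewrite mxE summxE; congr (_ * _).
  by apply: eq_bigr => k _; rewrite vcell_intE; apply: eq_box_int => v _; rewrite mxE.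
have coord (V W : cell MO -> 'rV[R]_3) (v w : cell MO -> R) i :
    \sum_j V j = \sum_j W j -> (forall j, V j 0 i = v j) -> (forall j, W j 0 i = w j) ->
    \sum_j v j = \sum_j w j.
  move=> /(congr1 (fun A : 'rV[R]_3 => A 0 i)); rewrite !summxE => VW Vv Ww.
  by rewrite -(eq_bigr _ (fun j _ => Vv j)) VW; apply: eq_bigr.
(* The projection identity is vector-valued: it is tested with component [i] of [E] and only its
   coordinate [i] is kept. *)
have projE i : \sum_j cell_int j (fun x => peval (E i j) x * peval (J i j) x) =
    \sum_j \sum_s \sum_k q s * cell_int j (fun x => peval (E i j) x * M s j k i x).
  apply: (coord _ _ _ _ i (proj (E i) (EX i))) => j; rewrite vcell_intE.
    by apply: eq_box_int => x _; rewrite !mxE.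
  have [_ cell_lin] := integral_on_cell j.
  rewrite pair_bigA /=.
  apply: (etrans _ (cell_lin _ (fun p : S * cell MV => q p.1)
    (fun p x => peval (E i j) x * M p.1 j p.2 i x) (fun p => cM p.1 j p.2 i))).
  apply: eq_box_int => x _; rewrite mxE currentE mulr_sumr.
  rewrite -(pair_bigA _ (fun s k => q s * (peval (E i j) x * M s j k i x))) /=.
  apply: eq_bigr => s _; rewrite mulr_sumr mulr_sumr; apply: eq_bigr => k _.
  by rewrite mulrCA.
rewrite exchange_big; under eq_bigr do rewrite projE.
have sums (P : S -> cell MO -> cell MV -> 'I_3 -> R) (Q : S -> cell MO -> cell MV -> R) :
    (forall s j k, Q s j k = \sum_i P s j k i) ->
    \sum_i \sum_j \sum_s \sum_k q s * P s j k i = \sum_s q s * \sum_j \sum_k Q s j k.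
  move=> QP; under [RHS]eq_bigr do rewrite mulr_sumr.
  rewrite [RHS]exchange_big [LHS]exchange_big /=; apply: eq_bigr => j _.
  rewrite [LHS]exchange_big; apply: eq_bigr => s _.
  rewrite exchange_big mulr_sumr; apply: eq_bigr => k _.
  by rewrite QP mulr_sumr.
by apply: sums => s j k; rewrite (cell_int_sum _ (cM s j k)).
Qed.

End Conservation.

Theorem proposition8 (R : realType) (MO MV : mesh R 3)
    (N : nat) (b : N.-tuple (mvpoly R (3 + 3)))
    (S : finType) (q m : S -> R) (eps0 mu0 : R) (T : set R)
    (f : S -> R -> phase_fun MO MV) (E B J : R -> config_vfield MO)
    (const_in_P : in_span b 1)
    (m_gt0 : forall s, 0 < m s) (eps0_gt0 : 0 < eps0) (mu0_gt0 : 0 < mu0)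
    (T_open : open T)
    (sol : dg_solution b q m eps0 mu0 T f E B J)
    (speed_sq_in_Vh : in_Vh b (fun (_ : cell MO) (_ : cell MV) => speed_sq R)) :
  forall t, T t ->
    [/\ derivable (fun tau => particle_energy m (fun s => f s tau)) t 1,
        derivable (fun tau => field_energy eps0 mu0 (E tau) (B tau)) t 1
      & derive1 (fun tau => particle_energy m (fun s => f s tau)) t
        + derive1 (fun tau => field_energy eps0 mu0 (E tau) (B tau)) t = 0].
Proof.
move=> t Tt.
have [f_in f_diff E_in B_in E_diff B_diff proj vlasov faraday ampere] := sol.
have dP := is_derive_particle_energy m T_open Tt f_in
  (fun s => f_diff s t Tt).
have dF := is_derive_field_energy eps0 mu0 T_open Tt E_in B_in (E_diff t Tt) (B_diff t Tt).
split; [exact: (@ex_derive _ _ _ _ _ _ _ dP) | exact: (@ex_derive _ _ _ _ _ _ _ dF) |].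
rewrite !derive1E (is_derive_val dP) (is_derive_val dF).
have kin s := kinetic_power (lt0r_neq0 (m_gt0 s)) speed_sq_in_Vh (vlasov s t Tt).
have field := field_power (E_in t Tt) (B_in t Tt) (faraday t Tt) (ampere t Tt).
have work := current_power (E_in t Tt) (proj t Tt).
(* [w] stands for the work of the electric field on the current: the particles gain it, and the
   field, whose balance comes multiplied by [mu0], loses it. *)
have balance (e u v w : R) : e * mu0 * u + v = - mu0 * w -> w + (e * u + mu0^-1 * v) = 0.
  clear -mu0_gt0 => h; apply: (mulfI (lt0r_neq0 mu0_gt0)).
  have mu0_neq0 := lt0r_neq0 mu0_gt0.
  rewrite mulr0 mulrDr mulrDr mulrA [mu0 * e]mulrC [mu0 * (_ * v)]mulVKf // h.
  by rewrite mulNr addrN.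
apply: (etrans (congr1 (fun w => w + _) (etrans (eq_bigr _ (fun s _ => kin s)) (esym work)))).
exact: balance field.
Qed.
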